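(* Let $G$ be a compact connected Lie group and let $(F,\varpi,G,\mu)$, $F\colon M\to N$, be a relative Hamiltonian $G$-space with a basic splitting $\mu=\nu\cdot\kappa$, and assume $\varpi=s\cdot\kappa$ for some $s\in\Omega^2(N)$. Then $$e^{z(s-\nu)}\cdot\kappa\in C_G(F),\qquad z\in\mathbb C,$$ is $d_G^F$-closed, where $s-\nu$ is regarded as an element of $\bigl(C^\infty(N,\mathfrak g^* )\oplus\Omega^2(N)\bigr)\subseteq C_G(N)$ of total degree $2$, and the module action $\cdot$ is extended to the Cartan models.
   Context: All manifolds and maps are $C^\infty$; $\mathfrak g$ is the Lie algebra of $G$; forms of negative degree are zero. For smooth $F\colon M\to N$: $\Omega^j(F)=\Omega^j(N)\oplus\Omega^{j-1}(M)$, $d_F(\alpha,\beta)=(d\alpha,F^*\alpha-d\beta)$. An $F$-pair $v=(v_N,v_M)$ consists of $F$-related vector fields; $\iota_v(\alpha,\beta)=(\iota_{v_N}\alpha,-\iota_{v_M}\beta)$, $\mathcal L_v=(\mathcal L_{v_N},\mathcal L_{v_M})$. Module action of $\gamma\in\Omega^{|\gamma|}(N)$: $\gamma\cdot(\alpha,\beta)=(\gamma\wedge\alpha,(-1)^{|\gamma|}F^*\gamma\wedge\beta)$. A relative pre-$k$-plectic form is a $d_F$-closed $\varpi\in\Omega^{k+1}(F)$. A relative Hamiltonian $G$-space: $G$ acts on $M$ and $N$ with $F$ equivariant, preserving the relative pre-$k$-plectic form $\varpi$, with equivariant $\mu\in\Omega^{k-1}(F)\otimes\mathfrak g^*$ satisfying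 $d_F\mu_\xi=-\iota_{v_\xi}\varpi$ and $\mathcal L_{v_\xi}\mu_\zeta=\mu_{[\xi,\zeta]}$, where $v_\xi=(v_\xi^N,v_\xi^M)$ is the fundamental $F$-pair, $v_\xi|_x=\frac{d}{dt}|_0\exp(-t\xi)x$. A basic splitting $\mu=\nu\cdot\kappa$: $\nu\in C^\infty(N,\mathfrak g^* )$, $\kappa\in\Omega^{k-1}(F)$ is $d_F$-closed, $G$-invariant, $\iota_{v_\xi}\kappa=0$ for all $\xi$, and $\mu_\xi=\nu_\xi\cdot\kappa$ for all $\xi$. Cartan models: $C_G(X)=(S(\mathfrak g^* )\otimes\Omega(X))^G$ with polynomial generators in degree $2$ and $(d_G\alpha)(\xi)=d(\alpha(\xi))-\iota_{v_\xi}(\alpha(\xi))$; $C^m_G(F)=C^m_G(N)\oplus C^{m-1}_G(M)$ with $d_G^F(\alpha,\beta)=(d_G\alpha,F^*\alpha-d_G\beta)$. The module action of $C_G(N)$ on $C_G(F)$ is given, for $\gamma\in C_G(N)$ homogeneous of total degree $|\gamma|$ and $(\alpha,\beta)\in C_G(F)$, by $(\gamma\cdot(\alpha,\beta))(\xi)=\bigl(\gamma(\xi)\wedge\alpha(\xi),\,(-1)^{|\gamma|}F^*(\gamma(\xi))\wedge\beta(\xi)\bigr)$ for each $\xi\in\mathfrak g$. Forms are complexified, and $e^{z(s-\nu)}$ is the (convergent, not polynomial in $\xi$) exponential series, $e^{z(s-\nu)}(\xi)=e^{-z\nu_\xi}e^{zs}$, so $C_G(F)$ is understood to include such analytic functions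 of $\xi$. *)

(* Defs.v *)
From HB Require Import structures.
From mathcomp Require Import all_boot all_order all_algebra.
From mathcomp Require Import all_classical all_reals all_analysis.
From mathcomp Require Import complex.

Set Implicit Arguments.
Unset Strict Implicit.
Unset Printing Implicit Defensive.

Import Order.TTheory GRing.Theory Num.Theory.
Import numFieldNormedType.Exports.

Local Open Scope classical_set_scope.
Local Open Scope complex_scope.
Local Open Scope ring_scope.

(* [C_k k U f]: f has k successive differentials at the points of U; in finite
   dimension, having it for all k on an open set U is the C^infty property. *)
Fixpoint C_k {R : realType} {V W : normedModType R} (k : nat)
    (U : set V) (f : V -> W) : Prop :=
  match k with
  | 0 => forall x, U x -> continuous_at x f
  | k'.+1 => (forall x, U x -> differentiable f x) /\
             (forall v, C_k k' U (fun x => 'D_v f x))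
  end.

Definition smooth_on {R : realType} {V W : normedModType R}
  (U : set V) (f : V -> W) : Prop := forall k, C_k k U f.

Record chart (R : realType) (n : nat) (X : topologicalType) := Chart {
  chart_dom : set X;
  chart_fun : X -> 'rV[R]_n;
  chart_inv : 'rV[R]_n -> X;
  chart_dom_open : open chart_dom;
  chart_img_open : open (chart_fun @` chart_dom);
  chart_funK : forall x, chart_dom x -> chart_inv (chart_fun x) = x;
  chart_fun_cont : {within chart_dom, continuous chart_fun};
  chart_inv_cont : {within chart_fun @` chart_dom, continuous chart_inv} }.

(* The atlas is any indexed family of smoothly compatible charts; [chart_at]
   selects, for each point, one chart of the atlas around it. *)
Record manifold (R : realType) := Manifold {
  carrier :> topologicalType;
  mdim : nat;
  atlas_index : Type;
  atlas : atlas_index -> chart R mdim carrier;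
  chart_at : carrier -> atlas_index;
  chart_atP : forall p, chart_dom (atlas (chart_at p)) p;
  atlas_smooth : forall i j,
    smooth_on
      (chart_fun (atlas i) @` (chart_dom (atlas i) `&` chart_dom (atlas j)))
      (chart_fun (atlas j) \o chart_inv (atlas i));
  manifold_hausdorff : hausdorff_space carrier;
  manifold_second_countable : @second_countable carrier }.

(* A tangent vector at p is given by its coordinates in the chart
   [chart_at p]; hence all tangent spaces share one carrier, but a vector is
   only meaningful together with its base point. *)
Definition tangent_space {R : realType} (M : manifold R) : normedModType R :=
  'rV[R]_(mdim M).

Definition pt_coord {R : realType} {M : manifold R} (p q : M) :
    tangent_space M :=
  chart_fun (atlas (chart_at p)) q.

Definition pt_uncoord {R : realType} {M : manifold R} (p : M)
    (y : tangent_space M) : M :=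
  chart_inv (atlas (chart_at p)) y.

Definition smooth_map {R : realType} {M N : manifold R} (F : M -> N) : Prop :=
  continuous F /\
  forall (i : atlas_index M) (j : atlas_index N),
    smooth_on (chart_fun (atlas i) @`
                 (chart_dom (atlas i) `&` (F @^-1` chart_dom (atlas j))))
      (chart_fun (atlas j) \o F \o chart_inv (atlas i)).

(* Smoothness of a map A x B -> C, in the product charts of A x B. *)
Definition smooth_map2 {R : realType} {A B C : manifold R}
    (f : A -> B -> C) : Prop :=
  continuous (fun ab : A * B => f ab.1 ab.2) /\
  forall (i : atlas_index A) (j : atlas_index B) (l : atlas_index C),
    smooth_on
      [set u : 'rV[R]_(mdim A + mdim B) | exists a b,
         [/\ chart_dom (atlas i) a, chart_dom (atlas j) b,
             chart_dom (atlas l) (f a b) &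
             u = row_mx (chart_fun (atlas i) a) (chart_fun (atlas j) b)]]
      (fun u => chart_fun (atlas l)
         (f (chart_inv (atlas i) (lsubmx u)) (chart_inv (atlas j) (rsubmx u)))).

Definition smooth_curve {R : realType} {M : manifold R} (c : R -> M) : Prop :=
  continuous c /\
  forall i : atlas_index M,
    smooth_on (c @^-1` chart_dom (atlas i)) (chart_fun (atlas i) \o c).

Definition smooth_fun {R : realType} {M : manifold R} (f : M -> R) : Prop :=
  forall i : atlas_index M,
    smooth_on (chart_fun (atlas i) @` chart_dom (atlas i))
      (f \o chart_inv (atlas i)).

Definition velocity {R : realType} {M : manifold R} (c : R -> M) (t : R) :
    tangent_space M :=
  derive1 (pt_coord (c t) \o c) t.

Definition tangent_map {R : realType} {M N : manifold R} (F : M -> N) (p : M)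
    (v : tangent_space M) : tangent_space N :=
  'd (pt_coord (F p) \o F \o pt_uncoord p) (pt_coord p p) v.

(* The two isomorphisms between T_qM and the coordinate space of the chart i,
   for q in the domain of the chart i. *)
Definition to_chart {R : realType} {M : manifold R} (i : atlas_index M) (q : M)
    (v : tangent_space M) : tangent_space M :=
  'd (chart_fun (atlas i) \o pt_uncoord q) (pt_coord q q) v.

Definition of_chart {R : realType} {M : manifold R} (i : atlas_index M) (q : M)
    (v : tangent_space M) : tangent_space M :=
  'd (pt_coord q \o chart_inv (atlas i)) (chart_fun (atlas i) q) v.

Definition vector_field {R : realType} (M : manifold R) := M -> tangent_space M.

Definition local_vf {R : realType} {M : manifold R} (i : atlas_index M)
    (X : vector_field M) (y : tangent_space M) : tangent_space M :=
  let q := chart_inv (atlas i) y in to_chart i q (X q).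

Definition lie_bracket {R : realType} {M : manifold R} (X Y : vector_field M) :
    vector_field M := fun p =>
  'D_(X p) (local_vf (chart_at p) Y) (pt_coord p p)
  - 'D_(Y p) (local_vf (chart_at p) X) (pt_coord p p).

(* A possibly inhomogeneous form: its degree-j component at p is the restriction
   of [omega p] to the lists of j tangent vectors at p. *)
Definition dform {R : realType} (M : manifold R) :=
  M -> seq (tangent_space M) -> R[i].

Definition local_form {R : realType} {M : manifold R} (i : atlas_index M)
    (omega : dform M) (y : tangent_space M) (vs : seq (tangent_space M)) :
    R[i] :=
  let q := chart_inv (atlas i) y in omega q [seq of_chart i q v | v <- vs].

Definition smooth_onC {R : realType} {V : normedModType R}
    (U : set V) (f : V -> R[i]) : Prop :=
  smooth_on U (fun x => complex.Re (f x)) /\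
  smooth_on U (fun x => complex.Im (f x)).

Definition deriveC {R : realType} {V : normedModType R}
    (f : V -> R[i]) (x v : V) : R[i] :=
  ('D_v (fun y => complex.Re (f y)) x) +i* ('D_v (fun y => complex.Im (f y)) x).

(* Membership in the complexified algebra of all differential forms. *)
Record Omega_total {R : realType} {M : manifold R} (omega : dform M) : Prop :=
  OmegaTotal {
  form_multilinear : forall p us vs (a : R) (v w : tangent_space M),
    omega p (us ++ (a *: v + w) :: vs)
    = a%:C * omega p (us ++ v :: vs) + omega p (us ++ w :: vs);
  form_alternating : forall p us vs ws (v : tangent_space M),
    omega p (us ++ v :: vs ++ v :: ws) = 0;
  form_smooth : forall (i : atlas_index M) vs,
    smooth_onC (chart_fun (atlas i) @` chart_dom (atlas i))
      (fun y => local_form i omega y vs) }.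

(* Real forms of degree j; for j < 0 only the zero form qualifies. *)
Definition Omega {R : realType} {M : manifold R} (j : int) (omega : dform M) :
    Prop :=
  [/\ Omega_total omega,
      (forall p vs, (size vs)%:Z != j -> omega p vs = 0) &
      (forall p vs, complex.Im (omega p vs) = 0)].

Definition form_scale {R : realType} {M : manifold R} (c : R[i])
    (omega : dform M) : dform M := fun p vs => c * omega p vs.

Definition form_of_fun {R : realType} {M : manifold R} (f : M -> R) : dform M :=
  fun p vs => if vs is [::] then (f p)%:C else 0.

(* Signature of the shuffle that moves the positions marked [true] in front of
   those marked [false]. *)
Fixpoint shuffle_sign (A : pzRingType) (b : seq bool) : A :=
  match b with
  | [::] => 1
  | true :: b' => shuffle_sign A b'
  | false :: b' => (-1) ^+ count id b' * shuffle_sign A b'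
  end.

Definition form_wedge {R : realType} {M : manifold R} (alpha beta : dform M) :
    dform M := fun p vs =>
  \sum_(b : (size vs).-tuple bool)
    shuffle_sign R[i] b * alpha p (mask b vs) * beta p (mask (map negb b) vs).

Definition ext_d {R : realType} {M : manifold R} (omega : dform M) : dform M :=
  fun p vs => \sum_(i < size vs)
    (-1) ^+ i *
    deriveC
      (fun y => local_form (chart_at p) omega y (take i vs ++ drop i.+1 vs))
      (pt_coord p p) (nth 0 vs i).

Definition int_mult {R : realType} {M : manifold R} (X : vector_field M)
    (omega : dform M) : dform M := fun p vs => omega p (X p :: vs).

Definition form_pullback {R : realType} {M N : manifold R} (F : M -> N)
    (omega : dform N) : dform M :=
  fun p vs => omega (F p) [seq tangent_map F p v | v <- vs].

(* (L_X omega)(Y_1, .., Y_j)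
     = X(omega(Y_1, .., Y_j)) - \sum_i omega(Y_1, .., [X, Y_i], .., Y_j)
   evaluated on fields Y_i = v_i that are constant in the chart at p, so that
   [X, Y_i] = - D_{v_i} X in that chart. *)
Definition lie_derivative {R : realType} {M : manifold R} (X : vector_field M)
    (omega : dform M) : dform M := fun p vs =>
  deriveC (fun y => local_form (chart_at p) omega y vs) (pt_coord p p) (X p)
  + \sum_(i < size vs)
      omega p (set_nth 0 vs i
        ('D_(nth 0 vs i) (local_vf (chart_at p) X) (pt_coord p p))).

(* [form_parity omega] multiplies the degree-j component of omega by (-1)^j. *)
Definition form_parity {R : realType} {M : manifold R} (omega : dform M) :
    dform M := fun p vs => (-1) ^+ size vs * omega p vs.

Definition cvgC {R : realType} (u : nat -> R[i]) (l : R[i]) : Prop :=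
  (fun n => complex.Re (u n)) @ \oo --> complex.Re l /\
  (fun n => complex.Im (u n)) @ \oo --> complex.Im l.

Definition limC {R : realType} (u : nat -> R[i]) : R[i] :=
  (lim ((fun n => complex.Re (u n)) @ \oo))
  +i* (lim ((fun n => complex.Im (u n)) @ \oo)).

Definition wedge_power {R : realType} {M : manifold R} (gamma : dform M)
    (n : nat) : dform M :=
  iter n (form_wedge gamma) (form_of_fun (fun=> 1)).

Definition form_exp {R : realType} {M : manifold R} (gamma : dform M) :
    dform M := fun p vs =>
  limC (fun m => \sum_(n < m) (n`!%:R)^-1 * wedge_power gamma n p vs).

Definition rel_form {R : realType} (M N : manifold R) : Type :=
  (dform N * dform M)%type.

Definition rel_Omega {R : realType} {M N : manifold R} (j : int)
    (a : rel_form M N) : Prop :=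
  Omega j a.1 /\ Omega (j - 1) a.2.

Definition rel_d {R : realType} {M N : manifold R} (F : M -> N)
    (a : rel_form M N) : rel_form M N :=
  (ext_d a.1, form_pullback F a.1 - ext_d a.2).

Definition rel_scale {R : realType} {M N : manifold R} (c : R[i])
    (a : rel_form M N) : rel_form M N :=
  (form_scale c a.1, form_scale c a.2).

Definition rel_int_mult {R : realType} {M N : manifold R}
    (vN : vector_field N) (vM : vector_field M) (a : rel_form M N) :
    rel_form M N := (int_mult vN a.1, - int_mult vM a.2).

Definition rel_lie_derivative {R : realType} {M N : manifold R}
    (vN : vector_field N) (vM : vector_field M) (a : rel_form M N) :
    rel_form M N := (lie_derivative vN a.1, lie_derivative vM a.2).

(* Module action, extended additively to inhomogeneous gamma.  In the Cartan
   model it is applied for each xi: since the polynomial generators have degree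
   2, the total degree |gamma| and the form degree of gamma(xi) have the same
   parity, so [form_parity] also accounts for the sign (-1)^|gamma| there. *)
Definition rel_act {R : realType} {M N : manifold R} (F : M -> N)
    (gamma : dform N) (a : rel_form M N) : rel_form M N :=
  (form_wedge gamma a.1, form_wedge (form_pullback F (form_parity gamma)) a.2).

(* [lg_exp] is the exponential map; it is determined by the group structure
   through [lg_exp_curve], [lg_expD] and [lg_exp_velocity]: t |-> exp(t xi) is
   the one-parameter subgroup with initial velocity xi. *)
Record lie_group (R : realType) := LieGroup {
  lg_manifold :> manifold R;
  lg_mul : lg_manifold -> lg_manifold -> lg_manifold;
  lg_one : lg_manifold;
  lg_inv : lg_manifold -> lg_manifold;
  lg_mulA : associative lg_mul;
  lg_mul1 : left_id lg_one lg_mul;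
  lg_mulV : left_inverse lg_one lg_inv lg_mul;
  lg_mul_smooth : smooth_map2 lg_mul;
  lg_inv_smooth : smooth_map lg_inv;
  lg_exp : tangent_space lg_manifold -> lg_manifold;
  lg_exp_curve : forall xi, smooth_curve (fun t : R => lg_exp (t *: xi));
  lg_expD : forall xi (t u : R),
    lg_exp ((t + u) *: xi) = lg_mul (lg_exp (t *: xi)) (lg_exp (u *: xi));
  lg_exp_velocity : forall xi,
    velocity (fun t : R => lg_exp (t *: xi)) 0 = xi }.

(* The Lie algebra is the tangent space at [lg_one]. *)
Definition lie_alg {R : realType} (G : lie_group R) : normedModType R :=
  tangent_space G.

Definition left_invariant {R : realType} {G : lie_group R} (xi : lie_alg G) :
    vector_field G := fun g => tangent_map (lg_mul g) (lg_one G) xi.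

Definition lie_alg_bracket {R : realType} {G : lie_group R}
    (xi zeta : lie_alg G) : lie_alg G :=
  lie_bracket (left_invariant xi) (left_invariant zeta) (lg_one G).

Definition Ad {R : realType} {G : lie_group R} (g : G) (xi : lie_alg G) :
    lie_alg G :=
  tangent_map (fun h => lg_mul (lg_mul g h) (lg_inv g)) (lg_one G) xi.

Record lie_action {R : realType} (G : lie_group R) (M : manifold R) :=
  LieAction {
  lact :> G -> M -> M;
  lact_one : forall x, lact (lg_one G) x = x;
  lact_mul : forall g h x, lact (lg_mul g h) x = lact g (lact h x);
  lact_smooth : smooth_map2 lact }.

Definition fundamental {R : realType} {G : lie_group R} {M : manifold R}
    (a : lie_action G M) (xi : lie_alg G) : vector_field M :=
  fun x => velocity (fun t : R => a (lg_exp ((- t) *: xi)) x) 0.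

Definition rel_pullback {R : realType} {G : lie_group R} {M N : manifold R}
    (aM : lie_action G M) (aN : lie_action G N) (g : G) (a : rel_form M N) :
    rel_form M N := (form_pullback (aN g) a.1, form_pullback (aM g) a.2).

Record rel_hamiltonian_space {R : realType} {G : lie_group R}
    {M N : manifold R} (F : M -> N) (aM : lie_action G M) (aN : lie_action G N)
    (k : nat) (varpi : rel_form M N) (mu : lie_alg G -> rel_form M N) : Prop :=
  RelHamiltonianSpace {
  rh_smooth : smooth_map F;
  rh_equivariant : forall g x, F (aM g x) = aN g (F x);
  rh_form : rel_Omega (k%:Z + 1) varpi;
  rh_closed : rel_d F varpi = 0;
  rh_invariant : forall g, rel_pullback aM aN g varpi = varpi;
  rh_mu_form : forall xi, rel_Omega (k%:Z - 1) (mu xi);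
  rh_mu_linear : forall (a : R) xi zeta,
    mu (a *: xi + zeta) = rel_scale a%:C (mu xi) + mu zeta;
  (* the equivariance mu_(Ad_g xi) = (g^-1)^* mu_xi *)
  rh_mu_equivariant : forall g xi,
    rel_pullback aM aN g (mu (Ad g xi)) = mu xi;
  rh_mu_moment : forall xi,
    rel_d F (mu xi)
    = - rel_int_mult (fundamental aN xi) (fundamental aM xi) varpi;
  rh_mu_bracket : forall xi zeta,
    rel_lie_derivative (fundamental aN xi) (fundamental aM xi) (mu zeta)
    = mu (lie_alg_bracket xi zeta) }.

Record basic_splitting {R : realType} {G : lie_group R}
    {M N : manifold R} (F : M -> N) (aM : lie_action G M) (aN : lie_action G N)
    (k : nat) (mu : lie_alg G -> rel_form M N)
    (nu : N -> lie_alg G -> R) (kappa : rel_form M N) : Prop :=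
  BasicSplitting {
  bs_nu_linear : forall x (a : R) xi zeta,
    nu x (a *: xi + zeta) = a * nu x xi + nu x zeta;
  bs_nu_smooth : forall xi, smooth_fun (fun x => nu x xi);
  bs_kappa_form : rel_Omega (k%:Z - 1) kappa;
  bs_kappa_closed : rel_d F kappa = 0;
  bs_kappa_invariant : forall g, rel_pullback aM aN g kappa = kappa;
  bs_kappa_basic : forall xi,
    rel_int_mult (fundamental aN xi) (fundamental aM xi) kappa = 0;
  bs_splitting : forall xi,
    mu xi = rel_act F (form_of_fun (fun x => nu x xi)) kappa }.

(* S^n(g^* ) (x) Omega(X): homogeneous polynomial maps of degree n from g to
   complex forms, written in the coordinates of g = R^(dim G). *)
Definition sym_forms {R : realType} {G : lie_group R} {X : manifold R}
    (n : nat) (P : lie_alg G -> dform X) : Prop :=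
  exists c : n.-tuple 'I_(mdim G) -> dform X,
    (forall t, Omega_total (c t)) /\
    forall (xi : 'rV[R]_(mdim G)) p vs,
      P xi p vs = \sum_(t : n.-tuple 'I_(mdim G))
        (\prod_(l < n) xi 0 (tnth t l))%:C * c t p vs.

(* C_G(X) for a manifold X with a G-action, with analytic dependence on xi: an
   element is an equivariant map from g to complex forms that is the sum of an
   everywhere convergent series of polynomial elements. *)
Record cartan {R : realType} {G : lie_group R} {X : manifold R}
    (a : lie_action G X) (alpha : lie_alg G -> dform X) : Prop := Cartan {
  cartan_form : forall xi, Omega_total (alpha xi);
  cartan_analytic : exists P : nat -> lie_alg G -> dform X,
    (forall n, sym_forms n (P n)) /\
    forall xi p vs,
      cvgC (fun m => \sum_(n < m) P n xi p vs) (alpha xi p vs);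
  cartan_invariant : forall g xi,
    form_pullback (a g) (alpha (Ad g xi)) = alpha xi }.

Definition cartan_d {R : realType} {G : lie_group R} {X : manifold R}
    (a : lie_action G X) (alpha : lie_alg G -> dform X) :
    lie_alg G -> dform X :=
  fun xi => ext_d (alpha xi) - int_mult (fundamental a xi) (alpha xi).

Definition rel_cartan {R : realType} {G : lie_group R} {M N : manifold R}
    (aM : lie_action G M) (aN : lie_action G N)
    (A : lie_alg G -> rel_form M N) : Prop :=
  cartan aN (fun xi => (A xi).1) /\ cartan aM (fun xi => (A xi).2).

Definition rel_cartan_d {R : realType} {G : lie_group R} {M N : manifold R}
    (F : M -> N) (aM : lie_action G M) (aN : lie_action G N)
    (A : lie_alg G -> rel_form M N) : lie_alg G -> rel_form M N := fun xi =>
  (cartan_d aN (fun zeta => (A zeta).1) xi,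
   form_pullback F (A xi).1 - cartan_d aM (fun zeta => (A zeta).2) xi).

Definition rel_cartan_act {R : realType} {G : lie_group R} {M N : manifold R}
    (F : M -> N) (gamma : lie_alg G -> dform N)
    (A : lie_alg G -> rel_form M N) : lie_alg G -> rel_form M N :=
  fun xi => rel_act F (gamma xi) (A xi).

Definition cartan_exp {R : realType} {G : lie_group R} {X : manifold R}
    (gamma : lie_alg G -> dform X) : lie_alg G -> dform X :=
  fun xi => form_exp (gamma xi).

Definition z_s_minus_nu {R : realType} {G : lie_group R} {N : manifold R}
    (z : R[i]) (s : dform N) (nu : N -> lie_alg G -> R) :
    lie_alg G -> dform N :=
  fun xi => form_scale z (s - form_of_fun (fun x => nu x xi)).

(* Main.v *)
Require Import Defs.
From HB Require Import structures.
From mathcomp Require Import all_boot all_order all_algebra.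
From mathcomp Require Import all_classical all_reals all_analysis.
From mathcomp Require Import complex ring lra zify.

Import Order.TTheory GRing.Theory Num.Theory.
Import numFieldNormedType.Exports.

Local Open Scope classical_set_scope.
Local Open Scope complex_scope.
Local Open Scope ring_scope.

                                                 

                                                                                
                                                                                   
                                                                      
(** Since $s-\nu$ is even, the sign in the module action disappears, and the components of
    $e^{z(s-\nu_\xi)}\cdot\kappa$ are $e^{-z\nu_\xi}e^{zs}\kappa_1$ on $N$ and
    $e^{-zF^*\nu_\xi}e^{zF^*s}\kappa_2$ on $M$ ([rel_act_exp]). Both are instances of one
    expression, [exp_form].

    The differentials of $s$ and $\nu$ are controlled after multiplication by $\kappa$. Closedness
    of $\varpi=s\cdot\kappa$ and of $\kappa$ gives $ds\wedge\kappa_1=0$, and the moment equation for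
    $\mu_\xi=\nu_\xi\cdot\kappa$ together with $\iota_{v_\xi}\kappa=0$ gives
    $d\nu_\xi\wedge\kappa_1=-\iota_{v_\xi}s\wedge\kappa_1$; the second components give the same
    identities for $F^*s$, $F^*\nu$ and $\kappa_2$. Hence, in the Cartan differential of
    $e^{-z\nu_\xi}e^{zs}\kappa_i$, the terms in $ds$ vanish, those in $d\nu_\xi$ and
    $\iota_{v_\xi}s$ cancel, and $e^{-z\nu_\xi}e^{zs}\,d\kappa_i$ remains ([flat_cartan_mexp] in a
    chart, [ext_d_exp_form] on the manifold). On $N$ this is zero since $d\kappa_1=0$; on $M$ it is
    the pullback of the $N$-component since $d\kappa_2=F^*\kappa_1$. This is $d_G^F$-closedness.

    Membership in the Cartan model ([cartan_exp_form]) also works through products with $\kappa$.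
    From $g^*s\wedge\kappa=s\wedge\kappa$ the two exponentials agree on $\kappa$ ([mexp_mul_eq]),
    and $\nu$ is equivariant wherever $\kappa$ is nonzero. Analyticity in $\xi$ is the exponential
    series of the scalar $-z\nu_\xi$ ([cartan_analytic_exp]).

    At a point, forms are handled as arbitrary functions on lists of vectors, an algebra under the
    signed shuffle product. Contraction with the first vector is a graded derivation, so identities
    are proved by induction on the list. The limit in [form_exp] is computed once ([mexp_cvg]) as a
    complex number [cexp] times a sum that is finite on every list. *)

Definition multiform (V : Type) (K : comNzRingType) := seq V -> K.
HB.instance Definition _ (V : Type) (K : comNzRingType) :=
  GRing.Zmodule.copy (multiform V K) (seq V -> K).

(** * The graded-commutative algebra of functions on lists of vectors *)

Section MultiformRing.
Context {V : Type} {K : comNzRingType}.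
Implicit Types (a b c : multiform V K) (v : V).

(** The formula of [form_wedge] at a single point, so that the two agree by computation. *)
Definition wedge a b : multiform V K := fun vs =>
  \sum_(t : (size vs).-tuple bool)
    shuffle_sign K t * a (mask t vs) * b (mask (map negb t) vs).

Definition contr v a : multiform V K := fun vs => a (v :: vs).

Definition parity a : multiform V K := fun vs => (-1) ^+ size vs * a vs.

Definition scalar_form (k : K) : multiform V K :=
  fun vs => if vs is [::] then k else 0.

Lemma big_tuple_cons n (f : n.+1.-tuple bool -> K) :
  \sum_t f t = \sum_(t : n.-tuple bool) f (cons_tuple true t)
             + \sum_(t : n.-tuple bool) f (cons_tuple false t).
Proof.
rewrite (reindex (fun x : bool * n.-tuple bool => cons_tuple x.1 x.2)) /=.
  by rewrite -(pair_bigA _ (fun x t => f (cons_tuple x t))) /= big_bool.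
exists (fun t => (thead t, [tuple of behead t])) => [[x t] _|t _] /=.
  by rewrite theadE; congr (_, _); apply/val_inj.
by rewrite [RHS]tuple_eta.
Qed.

Lemma size_mask_negb (t : bitseq) (vs : seq V) : size t = size vs ->
  (size (mask t vs) + size (mask (map negb t) vs))%N = size vs.
Proof.
move=> ht; rewrite !size_mask ?size_map // count_map -[RHS]ht.
by rewrite -(count_predC id t); congr (_ + _)%N; apply: eq_count.
Qed.

Lemma wedge_nil a b : wedge a b [::] = a [::] * b [::].
Proof.
rewrite /wedge /= (eq_bigl (xpred1 [tuple])) => [|t]; last first.
  by rewrite [t]tuple0 eqxx.
by rewrite big_pred1_eq /= mul1r.
Qed.

(** Shuffles are split by the factor that receives [v]. Moving [v] past the entries given to [a]
    costs the sign recorded by [parity]. This is the graded Leibniz rule for contraction, on which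
    the later inductions over lists rest. *)
Lemma wedge_cons a b v vs : wedge a b (v :: vs) =
  wedge (contr v a) b vs + wedge (parity a) (contr v b) vs.
Proof.
rewrite /wedge /= big_tuple_cons; congr (_ + _); apply: eq_bigr => t _ //=.
rewrite /parity size_mask ?size_tuple // mulrA.
by rewrite [(-1) ^+ _ * _]mulrC.
Qed.

Lemma parityK : involutive parity.
Proof. by move=> a; apply/funext => vs; rewrite /parity signrMK. Qed.

Lemma contrD v a b : contr v (a + b) = contr v a + contr v b.
Proof. by []. Qed.

Lemma contr_parity v a : contr v (parity a) = - parity (contr v a).
Proof. by apply/funext => vs; rewrite /contr /parity /= exprS mulN1r mulNr. Qed.

Lemma parityD a b : parity (a + b) = parity a + parity b.
Proof. by apply/funext => vs; rewrite /parity mulrDr. Qed.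

Lemma wedgeDl : left_distributive wedge +%R.
Proof.
move=> a b c; apply/funext => vs; rewrite [RHS]/GRing.add /= /wedge -big_split /=.
by apply: eq_bigr => t _; rewrite mulrDr mulrDl.
Qed.

Lemma wedgeDr : right_distributive wedge +%R.
Proof.
move=> a b c; apply/funext => vs; rewrite [RHS]/GRing.add /= /wedge -big_split /=.
by apply: eq_bigr => t _; rewrite mulrDr.
Qed.

Lemma contr_wedge v a b : contr v (wedge a b) =
  wedge (contr v a) b + wedge (parity a) (contr v b).
Proof. by apply/funext => vs; rewrite /contr wedge_cons. Qed.

Lemma parity_wedge a b : parity (wedge a b) = wedge (parity a) (parity b).
Proof.
apply/funext => vs; rewrite /parity /wedge mulr_sumr; apply: eq_bigr => t _.
have {1}-> : (-1) ^+ size vs = (-1) ^+ size (mask t vs)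
    * (-1) ^+ size (mask (map negb t) vs) :> K.
  by rewrite -exprD size_mask_negb ?size_tuple.
by ring.
Qed.

(** Both bracketings obey the same recursion under contraction and agree on the empty list. *)
Lemma wedgeA : associative wedge.
Proof.
move=> a b c; apply/funext => vs; elim: vs a b c => [|v vs IH] a b c.
  by rewrite !wedge_nil mulrA.
rewrite !wedge_cons !contr_wedge wedgeDl wedgeDr parity_wedge !fctE.
by rewrite !IH addrA.
Qed.

Lemma contr_scalar v (k : K) : contr v (scalar_form k) = 0.
Proof. by []. Qed.

Lemma wedge0l a : wedge 0 a = 0.
Proof. by apply: (addrI (wedge 0 a)); rewrite -wedgeDl !addr0. Qed.

Lemma wedge0r a : wedge a 0 = 0.
Proof. by apply: (addrI (wedge a 0)); rewrite -wedgeDr !addr0. Qed.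

Lemma parity_scalar (k : K) : parity (scalar_form k) = scalar_form k.
Proof. by apply/funext => -[|v vs]; rewrite /parity /= ?mul1r ?mulr0. Qed.

Lemma wedge_scalarl (k : K) a vs : wedge (scalar_form k) a vs = k * a vs.
Proof.
elim: vs a => [|v vs IH] a; first by rewrite wedge_nil.
by rewrite wedge_cons contr_scalar wedge0l parity_scalar IH add0r.
Qed.

Lemma wedge1l : left_id (scalar_form 1) wedge.
Proof. by move=> a; apply/funext => vs; rewrite wedge_scalarl mul1r. Qed.

Lemma wedge_scalarr (k : K) a vs : wedge a (scalar_form k) vs = a vs * k.
Proof.
elim: vs a => [|v vs IH] a; first by rewrite wedge_nil.
by rewrite wedge_cons contr_scalar wedge0r IH addr0.
Qed.

Lemma wedge1r : right_id (scalar_form 1) wedge.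
Proof. by move=> a; apply/funext => vs; rewrite wedge_scalarr mulr1. Qed.

Lemma scalar1_neq0 : scalar_form 1 != 0 :> multiform V K.
Proof. by apply/eqP => /(congr1 (@^~ [::]))/eqP; rewrite /= oner_eq0. Qed.

HB.instance Definition _ := GRing.Zmodule_isNzRing.Build (multiform V K)
  wedgeA wedge1l wedge1r wedgeDl wedgeDr scalar1_neq0.

Definition scale_form (k : K) a : multiform V K := fun vs => k * a vs.

Lemma scaleA k l a : scale_form k (scale_form l a) = scale_form (k * l) a.
Proof. by apply/funext => vs; rewrite /scale_form mulrA. Qed.

Lemma scale1 : left_id 1 scale_form.
Proof. by move=> a; apply/funext => vs; rewrite /scale_form mul1r. Qed.

Lemma scaleDr : right_distributive scale_form +%R.
Proof. by move=> k a b; apply/funext => vs; rewrite /scale_form mulrDr. Qed.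

Lemma scaleDl a : {morph scale_form^~ a : k l / k + l}.
Proof. by move=> k l; apply/funext => vs; rewrite /scale_form mulrDl. Qed.

HB.instance Definition _ := GRing.Zmodule_isLmodule.Build K (multiform V K)
  scaleA scale1 scaleDr scaleDl.

Lemma scale_wedgel k a b : k *: (a * b) = k *: a * b.
Proof.
apply/funext => vs; rewrite [LHS]mulr_sumr; apply: eq_bigr => t _.
by rewrite /GRing.scale /= /scale_form; ring.
Qed.

HB.instance Definition _ := GRing.Lmodule_isLalgebra.Build K (multiform V K)
  scale_wedgel.

Lemma scale_wedger k a b : k *: (a * b) = a * (k *: b).
Proof.
apply/funext => vs; rewrite [LHS]mulr_sumr; apply: eq_bigr => t _.
by rewrite /GRing.scale /= /scale_form; ring.
Qed.

HB.instance Definition _ := GRing.Lalgebra_isAlgebra.Build K (multiform V K)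
  scale_wedger.

Lemma multiform_mulE a b : wedge a b = a * b. Proof. by []. Qed.

Lemma multiform_scaleE k a vs : (k *: a) vs = k * a vs. Proof. by []. Qed.

Lemma multiform_addE a b vs : (a + b) vs = a vs + b vs. Proof. by []. Qed.

Lemma multiform_oppE a vs : (- a) vs = - a vs. Proof. by []. Qed.

Lemma multiform_sumE I (r : seq I) (P : pred I) (f : I -> multiform V K) vs :
  (\sum_(i <- r | P i) f i) vs = \sum_(i <- r | P i) f i vs.
Proof. by apply: (big_morph (@^~ vs)). Qed.

Lemma scalarE k : scalar_form k = k%:A.
Proof.
by apply/funext => -[|v vs]; rewrite multiform_scaleE /GRing.one /= ?mulr1 ?mulr0.
Qed.

Lemma contrM v a b :
  contr v (a * b) = contr v a * b + parity a * contr v b.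
Proof. exact: contr_wedge. Qed.

Lemma contrZ v k a : contr v (k *: a) = k *: contr v a.
Proof. by []. Qed.

Lemma parityM a b : parity (a * b) = parity a * parity b.
Proof. exact: parity_wedge. Qed.

Lemma parityZ k a : parity (k *: a) = k *: parity a.
Proof. by apply/funext => vs; rewrite /parity !multiform_scaleE mulrCA. Qed.

Lemma parity1 : parity 1 = 1. Proof. exact: parity_scalar. Qed.

Lemma parityX a n : parity a = a -> parity (a ^+ n) = a ^+ n.
Proof. by move=> ha; elim: n => [|n IH]; rewrite ?parity1 // exprS parityM ha IH. Qed.

                                                                                  
                
(** The two rules need one another: contraction makes an even [a] odd and an odd one even, so a
    single induction on the list carries both. *)
Lemma wedge_gradedC_at vs a b :
  (parity a = a -> (a * b) vs = (b * a) vs) /\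
  (parity a = - a -> (a * b) vs = (parity b * a) vs).
Proof.
elim: vs a b => [|v vs IH] a b.
  by rewrite -!multiform_mulE !wedge_nil /parity /= mul1r mulrC.
split=> ha; rewrite -[LHS]/(contr v (a * b) vs).
  rewrite -[RHS]/(contr v (b * a) vs) !contrM !multiform_addE ha.
  have hv : parity (contr v a) = - contr v a.
    by rewrite -[in RHS]ha contr_parity opprK.
  by rewrite (IH _ b).2 // (IH a _).1 // addrC.
rewrite -[RHS]/(contr v (parity b * a) vs) !contrM !multiform_addE ha.
have hv : parity (contr v a) = contr v a.
  by apply: oppr_inj; rewrite -contr_parity ha.
rewrite (IH _ b).1 // parityK mulNr multiform_oppE (IH a _).2 //.
by rewrite contr_parity mulNr multiform_oppE addrC.
Qed.

Lemma mul_evenC a b : parity a = a -> a * b = b * a.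
Proof. by move=> ha; apply/funext => vs; apply: (wedge_gradedC_at vs a b).1. Qed.

Lemma commX_even a n b : parity a = a -> a ^+ n * b = b * a ^+ n.
Proof. by move=> /parityX - /(_ n); apply: mul_evenC. Qed.

(** For [n = 1] this says that there is no scalar part. The powers of such an element vanish on
    short lists, which makes its exponential series finite on each list. *)
Definition vanishes n a := forall vs, (size vs < n)%N -> a vs = 0.

Lemma vanishesM m n a b :
  vanishes m a -> vanishes n b -> vanishes (m + n) (a * b).
Proof.
move=> ha hb vs hvs; rewrite /GRing.mul /= /wedge big1 // => t _.
have hs := size_mask_negb _ _ (size_tuple t).
have [hm|hm] := ltnP (size (mask t vs)) m; first by rewrite ha ?mulr0 ?mul0r.
rewrite [X in _ * X]hb ?mulr0 // -(ltn_add2l (size (mask t vs))) hs.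
by apply: leq_trans hvs _; rewrite leq_add2r.
Qed.

Lemma vanishesX a n : vanishes 1 a -> vanishes n (a ^+ n).
Proof.
move=> ha; elim: n => [|n IH]; first by move=> vs.
by rewrite exprS -add1n; apply: vanishesM.
Qed.

(** A shuffle hands each factor a sublist of [vs]. Inside a product evaluated at [vs], an
    exponential can therefore be replaced by a sufficiently long truncation. *)
Lemma mul_congr a a' b b' vs :
  (forall us, (size us <= size vs)%N -> a us = a' us) ->
  (forall us, (size us <= size vs)%N -> b us = b' us) ->
  (a * b) vs = (a' * b') vs.
Proof.
move=> ha hb; apply: eq_bigr => t _.
by rewrite ha ?hb // size_mask ?size_map ?size_tuple //
  -[X in (_ <= X)%N](size_tuple t) ?count_size // -(size_map negb) count_size.
Qed.

End MultiformRing.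

                     

(** * The complex exponential and its power series *)

Section ComplexExponential.
Context {R : realType}.
Implicit Types (c w : R[i]) (t : R).

(** Built from real functions, so that smoothness and derivatives are inherited from [expR], [cos]
    and [sin]; the link with the power series is [cexp_cvg]. *)
Definition cexp c : R[i] :=
  (expR (complex.Re c))%:C * (cos (complex.Im c) +i* sin (complex.Im c)).

Lemma complex_ReM (a b : R[i]) : complex.Re (a * b) =
  complex.Re a * complex.Re b - complex.Im a * complex.Im b.
Proof. by case: a b => [? ?] [? ?]. Qed.

Lemma complex_ImM (a b : R[i]) : complex.Im (a * b) =
  complex.Re a * complex.Im b + complex.Im a * complex.Re b.
Proof. by case: a b => [? ?] [? ?]. Qed.

Lemma complex_ReD (a b : R[i]) : complex.Re (a + b) = complex.Re a + complex.Re b.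
Proof. by case: a b => [? ?] [? ?]. Qed.

Lemma complex_ImD (a b : R[i]) : complex.Im (a + b) = complex.Im a + complex.Im b.
Proof. by case: a b => [? ?] [? ?]. Qed.

Lemma complex_eq_ReIm (a b : R[i]) :
  complex.Re a = complex.Re b -> complex.Im a = complex.Im b -> a = b.
Proof. by case: a b => [? ?] [? ?] /= -> ->. Qed.

                                                                                     
                                                                                    
                                                                                    
(** The power series in a real variable $t$ with these coefficients represents
    $\mathrm{Re}(we^{ct})$. The factor $w$ makes the family stable under differentiation, which
    replaces $w$ by $wc$; the choice $w=i$ gives access to imaginary parts. *)
Let coef w c n : R := n`!%:R^-1 * complex.Re (w * c ^+ n).

Let coef_diffs w c : pseries_diffs (coef w c) = coef (w * c) c.
Proof.
apply/funext => n; rewrite /pseries_diffs /coef factS natrM invfM !mulrA.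
by rewrite divff ?mul1r ?pnatr_eq0// -mulrA -exprS.
Qed.

Let Re_le_normc c : `|complex.Re c| <= Normc.normc c.
Proof.
by case: c => a b /=; rewrite -sqrtr_sqr ler_sqrt ?lerDl ?addr_ge0 ?sqr_ge0.
Qed.

Let normcX c n : Normc.normc (c ^+ n) = Normc.normc c ^+ n.
Proof.
elim: n => [|n IH]; first by rewrite !expr0 Normc.normc1.
by rewrite !exprS Normc.normcM IH.
Qed.

Let normc_ge0 c : 0 <= Normc.normc c.
Proof. by case: c => a b; rewrite sqrtr_ge0. Qed.

Let coef_cvg w c t : cvgn (pseries (coef w c) t).
Proof.
apply: normed_cvg; rewrite /normed_series_of /=.
pose r := Normc.normc c * `|t|.
apply: (@series_le_cvg _ _ (Normc.normc w *: exp_coeff r)) => [n|n|n|].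
- exact: normr_ge0.
- by rewrite mulr_ge0 ?normc_ge0 ?exp_coeff_ge0 ?mulr_ge0 ?normc_ge0.
- rewrite /coef !normrM ger0_norm ?invr_ge0 ?ler0n // normrX.
  have -> : (Normc.normc w *: exp_coeff r) n =
      n`!%:R^-1 * (Normc.normc w * Normc.normc c ^+ n) * `|t| ^+ n.
    transitivity (Normc.normc w * (r ^+ n / n`!%:R)) => //.
    by rewrite /r exprMn; ring.
  rewrite ler_wpM2r ?exprn_ge0 // ler_wpM2l ?invr_ge0 ?ler0n //.
  by apply: le_trans (Re_le_normc _) _; rewrite Normc.normcM normcX.
- by apply: is_cvg_seriesZ; apply: is_cvg_series_exp_coeff.
Qed.

Let ps w c t := limn (pseries (coef w c) t).

Let ps_derive w c t : is_derive t 1 (ps w c) (ps (w * c) c t).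
Proof.
rewrite /ps -coef_diffs; apply: (@pseries_snd_diffs _ _ (`|t| + 1)).
- exact: coef_cvg.
- by rewrite coef_diffs; exact: coef_cvg.
- by rewrite !coef_diffs; exact: coef_cvg.
- by rewrite [ltRHS]ger0_norm ?ltrDl.
Qed.

Lemma complex_Re_sum m (f : 'I_m -> R[i]) :
  complex.Re (\sum_(i < m) f i) = \sum_(i < m) complex.Re (f i).
Proof. by apply: (big_morph _ complex_ReD). Qed.

Let Re_natV n c : complex.Re (n`!%:R^-1 * c) = n`!%:R^-1 * complex.Re c.
Proof.
have -> : (n`!%:R^-1 : R[i]) = (n`!%:R^-1)%:C by rewrite fmorphV rmorph_nat.
by rewrite complex_ReM /= mul0r subr0.
Qed.

Let ps0 w c : ps w c 0 = complex.Re w.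
Proof.
apply: lim_near_cst => //; near=> m.
rewrite /pseries /series /= big_mkord; have m0 : (0 < m)%N by near: m; exists 1%N.
rewrite -(prednK m0) big_ord_recl /= big1 => [|i _]; last first.
  by rewrite exprS mul0r mulr0.
by rewrite /coef fact0 invr1 !expr0 !mulr1 mul1r addr0.
Unshelve. all: by end_near. Qed.

Let ps_cvg w c :
  (fun m => complex.Re (w * \sum_(n < m) (n`!%:R)^-1 * c ^+ n)) @ \oo --> ps w c 1.
Proof.
have := coef_cvg w c 1; rewrite -/(ps w c 1).
rewrite (_ : pseries _ _ =
  fun m => complex.Re (w * \sum_(n < m) (n`!%:R)^-1 * c ^+ n)) //.
apply/funext => m; rewrite /pseries /series /= mulr_sumr big_mkord complex_Re_sum.
by apply: eq_bigr => n _; rewrite expr1n mulr1 mulrCA Re_natV.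
Qed.

Let psE w x y t : ps (w * (x +i* y)) (x +i* y) t =
  x * ps w (x +i* y) t + y * ps (w * 'i%C) (x +i* y) t.
Proof.
pose c : R[i] := x +i* y; rewrite -/c.
apply: cvg_lim => //.
rewrite (_ : pseries _ _ =
  fun m => x * pseries (coef w c) t m + y * pseries (coef (w * 'i%C) c) t m).
  by apply: cvgD; apply: cvgMr; exact: coef_cvg.
apply/funext => m; rewrite /pseries /series /= !mulr_sumr -big_split /=.
apply: eq_bigr => n _; rewrite /coef.
have -> : complex.Re (w * c * c ^+ n) = x * complex.Re (w * c ^+ n)
    + y * complex.Re (w * 'i%C * c ^+ n).
  rewrite {1}/c; case: (c ^+ n) => a b; case: w => d e /=; ring.
by ring.
Qed.

Let psN w c t : ps (- w) c t = - ps w c t.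
Proof.
apply: cvg_lim => //.
rewrite (_ : pseries _ _ = fun m => - pseries (coef w c) t m).
  by apply: cvgN; exact: coef_cvg.
apply/funext => m; rewrite /pseries /series /= -sumrN.
apply: eq_bigr => n _; rewrite /coef mulNr.
by case: (w * _) => a b /=; ring.
Qed.

(** The real and imaginary parts of the series of $e^{ct}$ solve a linear system of differential
    equations. Multiplied by the closed expression for $e^{-ct}$ they become constant, and
    evaluation at $t=1$ identifies the sum. *)
Lemma cexp_cvg c : cvgC (fun m => \sum_(n < m) (n`!%:R)^-1 * c ^+ n) (cexp c).
Proof.
(* The real part and minus the imaginary part of the series of $e^{ct}$, because
   $\mathrm{Re}(iw)=-\mathrm{Im}\,w$. *)
pose g := ps 1 c; pose h := ps 'i%C c.
case: c @g @h => x y g h; set c := x +i* y in g h *.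
have dg t : is_derive t 1 g (x * g t + y * h t).
  apply: is_derive_eq (ps_derive 1 c t) _.
  by have := psE 1 x y t; rewrite [1 * 'i%C]mul1r.
have dh t : is_derive t 1 h (x * h t - y * g t).
  apply: is_derive_eq (ps_derive 'i%C c t) _.
  have -> : x * h t - y * g t = x * h t + y * ps (- 1) c t by rewrite psN mulrN.
  by have := psE 'i%C x y t; rewrite -[_ * 'i%C]expr2 sqr_i.
have d1 (k t : R) : is_derive t 1 (fun t => k * t) k.
  by apply: trigger_derive; rewrite [LHS]/GRing.scale /=; lra.
(* [P] and [- Q] are the real and imaginary parts of $e^{-xt}(\cos yt-i\sin yt)$ times $g-ih$, so
   they should be constantly $1$ and $0$. *)
pose P t := expR (- x * t) * (cos (y * t) * g t - sin (y * t) * h t).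
pose Q t := expR (- x * t) * (sin (y * t) * g t + cos (y * t) * h t).
have P1 : P 1 = 1.
  transitivity (P 0); last first.
    by rewrite /P !mulr0 expR0 cos0 sin0 mul0r /g ps0 /= subr0 !mul1r.
  apply: is_derive_0_is_cst => t; apply: trigger_derive.
  by rewrite /GRing.scale /=; ring.
have Q1 : Q 1 = 0.
  transitivity (Q 0); last first.
    by rewrite /Q !mulr0 expR0 cos0 sin0 mul0r /h ps0 /= add0r !mul1r.
  apply: is_derive_0_is_cst => t; apply: trigger_derive.
  by rewrite /GRing.scale /=; ring.
have ee : expR x * expR (- x) = 1 by rewrite expRxMexpNx_1.
have cs := cos2Dsin2 y.
have gE : g 1 = expR x * cos y.
  transitivity (expR x * expR (- x) * (cos y ^+ 2 + sin y ^+ 2) * g 1).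
    by rewrite ee cs !mul1r.
  transitivity (expR x * (cos y * P 1 + sin y * Q 1)).
    by rewrite /P /Q !mulr1; ring.
  by rewrite P1 Q1 mulr1 mulr0 addr0.
have hE : h 1 = - (expR x * sin y).
  transitivity (expR x * expR (- x) * (cos y ^+ 2 + sin y ^+ 2) * h 1).
    by rewrite ee cs !mul1r.
  transitivity (expR x * (cos y * Q 1 - sin y * P 1)).
    by rewrite /P /Q !mulr1; ring.
  by rewrite P1 Q1 mulr1 mulr0 add0r mulrN.
split.
  have := ps_cvg 1 c; rewrite -/g gE /cexp complex_ReM /= mul0r subr0.
  by under eq_fun do rewrite mul1r.
have /cvgN := ps_cvg 'i%C c; rewrite -/h hE opprK /cexp complex_ImM /= mul0r addr0.
rewrite (_ : - _ = fun m => complex.Im (\sum_(n < m) n`!%:R^-1 * c ^+ n)) //.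
by apply/funext => m; rewrite !fctE [X in complex.Re X]mulrC ReiNIm opprK.
Qed.
End ComplexExponential.

(** * Limits of complex sequences and truncated exponentials of sums *)

Section ComplexLimits.
Context {R : realType}.
Implicit Types (u v : nat -> R[i]) (k l : R[i]).

Lemma cvgC_lim u l : cvgC u l -> limC u = l.
Proof. by case=> hr hi; apply: complex_eq_ReIm => /=; apply: cvg_lim. Qed.

Lemma cvgC_cst k : cvgC (fun=> k) k.
Proof. by split; exact: cvg_cst. Qed.

Lemma cvgCD u v k l : cvgC u k -> cvgC v l -> cvgC (fun n => u n + v n) (k + l).
Proof.
move=> [ur ui] [vr vi]; split; rewrite (complex_ReD, complex_ImD).
  by under eq_fun do rewrite complex_ReD; exact: cvgD.
by under eq_fun do rewrite complex_ImD; exact: cvgD.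
Qed.

Lemma cvgCM u v k l : cvgC u k -> cvgC v l -> cvgC (fun n => u n * v n) (k * l).
Proof.
move=> [ur ui] [vr vi]; split; rewrite (complex_ReM, complex_ImM).
  by under eq_fun do rewrite complex_ReM; apply: cvgB; exact: cvgM.
by under eq_fun do rewrite complex_ImM; apply: cvgD; exact: cvgM.
Qed.

Lemma cvgC_sum m (u : 'I_m -> nat -> R[i]) (l : 'I_m -> R[i]) :
  (forall i, cvgC (u i) (l i)) ->
  cvgC (fun n => \sum_(i < m) u i n) (\sum_(i < m) l i).
Proof.
elim: m u l => [|m IH] u l h.
  by rewrite big_ord0; under eq_fun do rewrite big_ord0; apply: cvgC_cst.
rewrite big_ord_recl; under eq_fun do rewrite big_ord_recl.
by apply: cvgCD => //; apply: IH.
Qed.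

Lemma cvgC_near u v l : (\forall n \near \oo, u n = v n) -> cvgC u l -> cvgC v l.
Proof.
move=> uv [ur ui]; split.
  apply: cvg_trans ur; apply: near_eq_cvg.
  by apply: filterS uv => n ->.
apply: cvg_trans ui; apply: near_eq_cvg.
by apply: filterS uv => n ->.
Qed.

Lemma cvgC_subn i u l : cvgC u l -> cvgC (fun m => u (m - i)%N) l.
Proof.
have h : (fun m => (m - i)%N) @ \oo --> \oo by apply: cvg_subnr.
by move=> [ur ui]; split; [exact: cvg_comp h ur|exact: cvg_comp h ui].
Qed.

End ComplexLimits.

(** Collecting by powers of [a], the coefficient of $a^i/i!$ is the series of $e^k$ cut after
    [m - i] terms. Scalars are central, so the binomial theorem computes the summand added at each
    induction step. *)
Lemma exp_partial_sumD {K : numFieldType} {A : algType K} (k : K) (a : A) m :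
  \sum_(n < m) n`!%:R^-1 *: (k%:A + a) ^+ n =
  \sum_(i < m) (\sum_(n < m - i) n`!%:R^-1 * k ^+ n) *: (i`!%:R^-1 *: a ^+ i).
Proof.
elim: m => [|m IH]; first by rewrite !big_ord0.
rewrite big_ord_recr /= IH [RHS]big_ord_recr /= subSnn big_ord1.
under [in RHS]eq_bigr => i _ do
  rewrite subSn ?(ltnW (ltn_ord i)) // big_ord_recr /= scalerDl.
rewrite big_split /= -addrA; congr (_ + _).
rewrite exprDn_comm; last by apply: commr_sym; rewrite /GRing.comm mulr_algl
  mulr_algr.
rewrite scaler_sumr big_ord_recr /=; congr (_ + _).
  apply: eq_bigr => i _; rewrite -[(_ * _) *+ _]scaler_nat exprZn expr1n
    mulr_algl !scalerA.
  congr (_ *: _); have im := ltnW (ltn_ord i).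
  have := bin_fact im => /(congr1 (fun n => n%:R : K)); rewrite !natrM => <-.
  have := bin_gt0 m i; rewrite im => hb.
  by field; rewrite !pnatr_eq0 -!lt0n !fact_gt0 hb.
by rewrite subnn binn mulr1n expr0 fact0 invr1 mul1r mul1r scale1r.
Qed.

(** * Exponentials of elements without scalar part *)

Section ExponentialForm.
Context {R : realType} {V : Type}.
Implicit Types (a b : multiform V R[i]) (k : R[i]) (vs : seq V).

Definition texp m a : multiform V R[i] := \sum_(n < m) n`!%:R^-1 *: a ^+ n.

                                                                                    
                                                                           
(** If [a] has no scalar part, its powers beyond the length of a list vanish on that list.
    Truncating by the length loses nothing then, and replaces the limit by algebra. *)
Definition mexp a : multiform V R[i] := fun vs => texp (size vs).+1 a vs.

Lemma texp_mexp m a vs : vanishes 1 a -> (size vs < m)%N ->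
  texp m a vs = mexp a vs.
Proof.
move=> ha hm; rewrite /mexp /texp -(subnKC hm) big_split_ord /= multiform_addE.
rewrite [X in _ + X]multiform_sumE [X in _ + X]big1 ?addr0 // => i _.
rewrite multiform_scaleE (vanishesX a ((size vs).+1 + i)) ?mulr0 //.
by rewrite addSn ltnS leq_addr.
Qed.

(** The rule $e^{k+a}=e^ke^a$ at the level of series: finitely many powers $a^i$ survive on [vs],
    each with a coefficient tending to $e^k/i!$. *)
Lemma mexp_cvg k a vs : vanishes 1 a ->
  cvgC (fun m => \sum_(n < m) n`!%:R^-1 * ((k%:A + a) ^+ n) vs)
       (cexp k * mexp a vs).
Proof.
move=> ha; set B := (size vs).+1.
apply: (@cvgC_near _ (fun m => \sum_(i < B)
   (\sum_(n < m - i) n`!%:R^-1 * k ^+ n) * (i`!%:R^-1 * (a ^+ i) vs))); last first.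
  rewrite /mexp /texp multiform_sumE mulr_sumr; apply: cvgC_sum => i.
  apply: cvgCM (cvgC_cst _); exact: (cvgC_subn i _ _ (cexp_cvg k)).
exists B => // m /= Bm.
transitivity ((\sum_(n < m) n`!%:R^-1 *: (k%:A + a) ^+ n) vs); last first.
  by rewrite multiform_sumE.
rewrite exp_partial_sumD multiform_sumE -(subnKC Bm) big_split_ord /=.
rewrite [X in _ + X]big1 ?addr0 // => i _.
rewrite !multiform_scaleE (vanishesX a (B + i)) ?mulr0 //.
by rewrite addSn ltnS leq_addr.
Qed.

End ExponentialForm.

                         

(** * Differentiability and smoothness on normed spaces *)

Section NearEq.
Context {R : realType} {V W : normedModType R}.

(** The differential is characterised by its first-order expansion. That expansion passes to [g]
    because the two functions agree near [x], and uniqueness then identifies the differentials. *)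
Lemma near_eq_diff (f g : V -> W) x :
  (\near x, f x = g x) -> differentiable f x ->
  differentiable g x /\ 'd g x = 'd f x :> (V -> W).
Proof.
move=> fg df; have fgx : f x = g x by apply: nbhs_singleton fg.
have eg : g \o shift x = cst (g x) + 'd f x +o_ 0 id.
  have /eqaddoP ef := diff_locally df.
  apply/eqaddoP => e e0; have {}ef := ef e e0.
  have fg0 : \forall y \near (0 : V), f (y + x) = g (y + x).
    have := fg; rewrite (near_shift 0 x) => h.
    by apply: filterS h => y; rewrite /= subr0.
  apply: filterS2 ef fg0 => y /=; rewrite !fctE /= => h1 h2.
  by rewrite -h2 -fgx.
have dgE := diff_unique (diff_continuous df) eg.
by split=> //; apply/diff_locallyP; rewrite dgE; split=> //; apply: diff_continuous.
Qed.

End NearEq.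

Section Ck.
Context {R : realType}.

Lemma C_k_diff {V W : normedModType R} k (U : set V) (f : V -> W) x :
  C_k k.+1 U f -> U x -> differentiable f x.
Proof. by move=> [h _]; apply: h. Qed.

(** The conditions in [C_k], including those on iterated derivatives, are imposed point by point.
    Smoothness can therefore be established near each point separately. *)
Lemma C_kP {V W : normedModType R} k (U : set V) (f : V -> W) :
  C_k k U f <-> forall x, U x -> C_k k [set x] f.
Proof.
elim: k f => [|k IH] f /=; split.
- by move=> h x Ux y /= ->; apply: h.
- by move=> h x Ux; apply: h Ux _ _.
- move=> [h1 h2] x Ux; split=> [y /= -> |v]; first exact: h1.
  by have [+ _] := IH ('D_v f); apply.
- move=> h; split=> [x Ux|v]; first by have [h1 _] := h x Ux; apply: h1.
  by apply/IH => x Ux; have [_ /(_ v)] := h x Ux.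
Qed.

Lemma C_kW {V W : normedModType R} k (U : set V) (f : V -> W) :
  C_k k.+1 U f -> C_k k U f.
Proof.
elim: k f => [|k IH] f; first by move=> [h _] x Ux; apply/differentiable_continuous/h.
by move=> [h1 h2]; split=> // v; apply: IH.
Qed.

(** Openness makes functions equal on [U] equal near each point of [U], so their derivatives agree
    there as well. *)
Lemma C_k_ext {V W : normedModType R} k (U : set V) (f g : V -> W) :
  open U -> (forall x, U x -> f x = g x) -> C_k k U f -> C_k k U g.
Proof.
move=> oU; have near (f' g' : V -> W) : (forall x, U x -> f' x = g' x) ->
    forall x, U x -> \near x, f' x = g' x.
  by move=> h x Ux; apply: filterS h _; apply: open_nbhs_nbhs.
elim: k f g => [|k IH] f g fg.
  move=> h x Ux; rewrite /continuous_at -fg //.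
  by apply: cvg_trans (h x Ux); apply: near_eq_cvg; apply: near.
move=> [h1 h2]; split=> [x Ux|v].
  by have [] := near_eq_diff _ _ _ (near _ _ fg x Ux) (h1 x Ux).
apply: IH (h2 v) => x Ux; apply: near_eq_derive; exact: near.
Qed.

Lemma C_k_cst {V W : normedModType R} k (U : set V) (c : W) : C_k k U (fun=> c).
Proof.
elim: k c => [|k IH] c /=; first by move=> x _; apply: cvg_cst.
split=> [x _|v]; first exact: differentiable_cst.
have -> : 'D_v (fun=> c) = fun=> 0 :> W; last exact: IH.
by apply/funext => x; exact: derive_cst.
Qed.

Section Scalar.
Context {V : normedModType R}.
Implicit Types (U : set V) (f g : V -> R).

Lemma C_kD k U f g : open U -> C_k k U f -> C_k k U g ->
  C_k k U (fun x => f x + g x).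
Proof.
move=> oU; elim: k f g => [|k IH] f g.
  by move=> hf hg x Ux; apply: cvgD; [apply: hf|apply: hg].
move=> [f1 f2] [g1 g2]; split=> [x Ux|v].
  by apply: differentiableD; [apply: f1|apply: g1].
apply: C_k_ext oU _ (IH _ _ (f2 v) (g2 v)) => x Ux.
by rewrite (@deriveD _ _ _ f g) //; apply: diff_derivable; [apply: f1|apply: g1].
Qed.

Lemma C_kM k U f g : open U -> C_k k U f -> C_k k U g ->
  C_k k U (fun x => f x * g x).
Proof.
move=> oU; elim: k f g => [|k IH] f g.
  by move=> hf hg x Ux; apply: cvgM; [apply: hf|apply: hg].
move=> hf hg; have [f0 g0] := (C_kW _ _ _ hf, C_kW _ _ _ hg).
move: hf hg => [f1 f2] [g1 g2]; split=> [x Ux|v].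
  by apply: differentiableM; [apply: f1|apply: g1].
apply: C_k_ext oU _ (C_kD _ _ _ _ oU (IH _ _ f0 (g2 v)) (IH _ _ g0 (f2 v))) => x Ux.
by rewrite (@deriveM _ _ f g) //; apply: diff_derivable; [apply: f1|apply: g1].
Qed.

Lemma C_kN k U f : open U -> C_k k U f -> C_k k U (fun x => - f x).
Proof.
move=> oU hf.
have := C_kM _ _ _ _ oU (C_k_cst k U (-1 : R)) hf.
by apply: C_k_ext oU _ => x _; rewrite mulN1r.
Qed.

Lemma C_k_sum k U I (r : seq I) (f : I -> V -> R) : open U ->
  (forall i, C_k k U (f i)) -> C_k k U (fun x => \sum_(i <- r) f i x).
Proof.
move=> oU h; elim: r => [|i r IH].
  by under eq_fun do rewrite big_nil; apply: C_k_cst.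
by under eq_fun do rewrite big_cons; apply: C_kD.
Qed.

Lemma diff_comp1 f (h : R -> R) d x : differentiable f x ->
  is_derive (f x) 1 h d ->
  differentiable (h \o f) x /\ forall v, 'D_v (h \o f) x = d * 'D_v f x.
Proof.
move=> df [dh hd].
have dh' : differentiable h (f x) by apply/derivable1_diffP.
split=> [|v]; first exact: differentiable_comp.
rewrite !deriveE //; last exact: differentiable_comp.
rewrite diff_comp //= (deriv1E dh) derive1E hd.
by rewrite mulrC.
Qed.

Lemma C_k_expR k U f : open U -> C_k k U f -> C_k k U (fun x => expR (f x)).
Proof.
move=> oU; elim: k f => [|k IH] f hf.
  by move=> x Ux; apply: continuous_comp; [apply: hf|apply: continuous_expR].
have h x (Ux : U x) := diff_comp1 _ _ _ _ (hf.1 x Ux) (is_derive_expR (f x)).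
split=> [x Ux|v]; first exact: (h x Ux).1.
have := C_kM _ _ _ _ oU (IH _ (C_kW _ _ _ hf)) (hf.2 v).
by apply: C_k_ext oU _ => x Ux; rewrite (h x Ux).2.
Qed.

Lemma C_k_trigo k U f : open U -> C_k k U f ->
  C_k k U (fun x => cos (f x)) /\ C_k k U (fun x => sin (f x)).
Proof.
move=> oU; elim: k f => [|k IH] f hf.
  by split=> x Ux; apply: continuous_comp; try exact: hf;
    [apply: continuous_cos|apply: continuous_sin].
have hc x (Ux : U x) := diff_comp1 _ _ _ _ (hf.1 x Ux) (is_derive_cos (f x)).
have hs x (Ux : U x) := diff_comp1 _ _ _ _ (hf.1 x Ux) (is_derive_sin (f x)).
have [ic is_] := IH _ (C_kW _ _ _ hf).
split; split=> [x Ux|v]; try exact: (hc x Ux).1; try exact: (hs x Ux).1.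
  have := C_kM _ _ _ _ oU (C_kN _ _ _ oU is_) (hf.2 v).
  by apply: C_k_ext oU _ => x Ux; rewrite (hc x Ux).2.
have := C_kM _ _ _ _ oU ic (hf.2 v).
by apply: C_k_ext oU _ => x Ux; rewrite (hs x Ux).2.
Qed.

Lemma C_k_coord n k U (g : V -> 'rV[R]_n) l : open U -> C_k k U g ->
  C_k k U (fun x => g x 0 l).
Proof.
move=> oU; elim: k g => [|k IH] g.
  move=> h x Ux; apply: (@continuous_comp _ _ _ g (fun M => M 0 l)).
    exact: h.
  exact: coord_continuous.
move=> [h1 h2]; split=> [x Ux|v].
  apply: (@differentiable_comp _ _ _ _ g (fun M => M 0 l)); first exact: h1.
  exact: differentiable_coord.
apply: C_k_ext oU _ (IH _ (h2 v)) => x Ux.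
by rewrite derive_mx ?mxE //; apply/diff_derivable/h1.
Qed.

(** The induction uses the chain rule in coordinates, $D_v(f\circ
    g)=\sum_l(D_vg)_l\,(\partial_lf)\circ g$, a sum of products of functions of class one lower. *)
Lemma C_k_comp n k U (B : set 'rV[R]_n) (g : V -> 'rV[R]_n) (f : 'rV[R]_n -> R) :
  open U -> (forall x, U x -> B (g x)) -> C_k k U g -> C_k k B f ->
  C_k k U (f \o g).
Proof.
move=> oU UB; elim: k f => [|k IH] f hg hf.
  by move=> x Ux; apply: continuous_comp; [apply: hg|apply: hf; apply: UB].
have df x (Ux : U x) := C_k_diff _ _ _ _ hf (UB x Ux).
have dg x (Ux : U x) := C_k_diff _ _ _ _ hg Ux.
split=> [x Ux|v]; first by apply: differentiable_comp; [apply: dg|apply: df].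
have h : C_k k U (fun x => \sum_(l < n)
    'D_v g x 0 l * ('D_(delta_mx 0 l) f \o g) x).
  apply: C_k_sum => // l; apply: C_kM => //.
    by apply: C_k_coord => //; apply: hg.2.
  by apply: IH; [apply: C_kW|apply: hf.2].
apply: C_k_ext oU _ h => x Ux.
have [dfx dgx] := (df x Ux, dg x Ux).
rewrite [RHS]deriveE; last exact: differentiable_comp.
rewrite diff_comp //= -(deriveE v dgx) [X in _ = 'd f _ X]row_sum_delta linear_sum.
by apply: eq_bigr => l _; rewrite linearZ /= (deriveE _ dfx).
Qed.

End Scalar.
End Ck.

(** * Complex-valued smooth functions and their derivatives *)

Section ComplexSmooth.
Context {R : realType} {V : normedModType R}.
Implicit Types (U : set V) (f g : V -> R[i]) (x v : V) (c : R[i]).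

Lemma smooth_onC_ext U f g : open U -> (forall x, U x -> f x = g x) ->
  smooth_onC U f -> smooth_onC U g.
Proof.
by move=> oU fg [h1 h2]; split=> k; [apply: C_k_ext oU _ (h1 k)|
  apply: C_k_ext oU _ (h2 k)] => x Ux; rewrite fg.
Qed.

Lemma smooth_onC_cst U c : smooth_onC U (fun=> c).
Proof. by split=> k; apply: C_k_cst. Qed.

Lemma smooth_onC_real U (f : V -> R) : smooth_on U f ->
  smooth_onC U (fun x => (f x)%:C).
Proof. by move=> h; split=> //= k; apply: C_k_cst. Qed.

Lemma smooth_onCD U f g : open U -> smooth_onC U f -> smooth_onC U g ->
  smooth_onC U (fun x => f x + g x).
Proof.
move=> oU [f1 f2] [g1 g2]; split=> k.
  by under eq_fun do rewrite complex_ReD; apply: C_kD.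
by under eq_fun do rewrite complex_ImD; apply: C_kD.
Qed.

Lemma smooth_onCM U f g : open U -> smooth_onC U f -> smooth_onC U g ->
  smooth_onC U (fun x => f x * g x).
Proof.
move=> oU [f1 f2] [g1 g2]; split=> k.
  under eq_fun do rewrite complex_ReM.
  by apply: C_kD => //; [|apply: C_kN => //]; apply: C_kM.
by under eq_fun do rewrite complex_ImM; apply: C_kD => //; apply: C_kM.
Qed.

Lemma smooth_onC_sum U I (r : seq I) (f : I -> V -> R[i]) : open U ->
  (forall i, smooth_onC U (f i)) -> smooth_onC U (fun x => \sum_(i <- r) f i x).
Proof.
move=> oU h; elim: r => [|i r IH].
  by under eq_fun do rewrite big_nil; apply: smooth_onC_cst.
by under eq_fun do rewrite big_cons; apply: smooth_onCD.
Qed.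

Lemma smooth_onC_prod U I (r : seq I) (f : I -> V -> R[i]) : open U ->
  (forall i, smooth_onC U (f i)) -> smooth_onC U (fun x => \prod_(i <- r) f i x).
Proof.
move=> oU h; elim: r => [|i r IH].
  by under eq_fun do rewrite big_nil; apply: smooth_onC_cst.
by under eq_fun do rewrite big_cons; apply: smooth_onCM.
Qed.

Lemma smooth_onC_cexp U f : open U -> smooth_onC U f ->
  smooth_onC U (fun x => cexp (f x)).
Proof.
move=> oU [f1 f2]; apply: smooth_onCM => //.
  by apply: smooth_onC_real => k; apply: C_k_expR.
by split=> k /=; have [] := C_k_trigo k _ _ oU (f2 k).
Qed.

Lemma smooth_onC_comp n U (B : set 'rV[R]_n) (g : V -> 'rV[R]_n)
    (f : 'rV[R]_n -> R[i]) :
  open U -> (forall x, U x -> B (g x)) -> smooth_on U g -> smooth_onC B f ->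
  smooth_onC U (f \o g).
Proof.
by move=> oU UB hg [f1 f2]; split=> k;
  [apply: (C_k_comp _ _ _ _ _ _ oU UB (hg k) (f1 k))|
   apply: (C_k_comp _ _ _ _ _ _ oU UB (hg k) (f2 k))].
Qed.

Lemma smooth_onC_local U f :
  (forall x, U x -> exists A, A x /\ smooth_onC A f) -> smooth_onC U f.
Proof.
by move=> h; split=> k; apply/C_kP => x /h[A [Ax [h1 h2]]];
  [move: (h1 k)|move: (h2 k)] => /C_kP; apply.
Qed.

Definition differentiableC f x :=
  differentiable (fun y => complex.Re (f y)) x /\
  differentiable (fun y => complex.Im (f y)) x.

Lemma smooth_onC_differentiable U f x :
  smooth_onC U f -> U x -> differentiableC f x.
Proof. by move=> [h1 h2] Ux; split; [apply: (h1 1%N).1|apply: (h2 1%N).1]. Qed.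

Lemma deriveC_cst c x v : deriveC (fun=> c) x v = 0.
Proof.
by apply: complex_eq_ReIm; [exact: (derive_cst (complex.Re c))|
  exact: (derive_cst (complex.Im c))].
Qed.

Lemma differentiableC_cst c x : differentiableC (fun=> c) x.
Proof. by split; apply: differentiable_cst. Qed.

Lemma differentiableCD f g x : differentiableC f x -> differentiableC g x ->
  differentiableC (fun y => f y + g y) x.
Proof.
move=> [f1 f2] [g1 g2]; split.
  by under eq_fun do rewrite complex_ReD; apply: differentiableD.
by under eq_fun do rewrite complex_ImD; apply: differentiableD.
Qed.

Lemma deriveCD f g x v : differentiableC f x -> differentiableC g x ->
  deriveC (fun y => f y + g y) x v = deriveC f x v + deriveC g x v.
Proof.
move=> [f1 f2] [g1 g2]; apply: complex_eq_ReIm => /=.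
  by under eq_fun do rewrite complex_ReD; apply: deriveD; apply: diff_derivable.
by under eq_fun do rewrite complex_ImD; apply: deriveD; apply: diff_derivable.
Qed.

Lemma differentiableCM f g x : differentiableC f x -> differentiableC g x ->
  differentiableC (fun y => f y * g y) x.
Proof.
move=> [f1 f2] [g1 g2]; split.
  under eq_fun do rewrite complex_ReM.
  by apply: differentiableB; apply: differentiableM.
under eq_fun do rewrite complex_ImM.
by apply: differentiableD; apply: differentiableM.
Qed.

Lemma deriveCM f g x v : differentiableC f x -> differentiableC g x ->
  deriveC (fun y => f y * g y) x v = deriveC f x v * g x + f x * deriveC g x v.
Proof.
move=> [f1 f2] [g1 g2]; set f1' := fun y => complex.Re (f y) in f1 *.
set f2' := fun y => complex.Im (f y) in f2 *.
set g1' := fun y => complex.Re (g y) in g1 *.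
set g2' := fun y => complex.Im (g y) in g2 *.
have d (a b : V -> R) : differentiable a x -> differentiable b x ->
    'D_v (fun y => a y * b y) x = a x * 'D_v b x + b x * 'D_v a x :> R.
  by move=> ha hb; rewrite (@deriveM _ _ a b) //; apply: diff_derivable.
apply: complex_eq_ReIm.
  rewrite [LHS]/=; under eq_fun do rewrite complex_ReM.
  rewrite (@deriveB _ _ _ (fun y => f1' y * g1' y) (fun y => f2' y * g2' y));
    do ?[by apply/diff_derivable/differentiableM].
  rewrite !d // complex_ReD !complex_ReM /= -/f1' -/f2' -/g1' -/g2' /f1' /f2'
    /g1' /g2'; ring.
rewrite [LHS]/=; under eq_fun do rewrite complex_ImM.
rewrite (@deriveD _ _ _ (fun y => f1' y * g2' y) (fun y => f2' y * g1' y));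
    do ?[by apply/diff_derivable/differentiableM].
rewrite !d // complex_ImD !complex_ImM /= -/f1' -/f2' -/g1' -/g2' /f1' /f2' /g1'
  /g2'; ring.
Qed.

Lemma differentiableC_sum I (r : seq I) (f : I -> V -> R[i]) x :
  (forall i, differentiableC (f i) x) ->
  differentiableC (fun y => \sum_(i <- r) f i y) x.
Proof.
move=> h; elim: r => [|i r IH].
  by under eq_fun do rewrite big_nil; apply: differentiableC_cst.
by under eq_fun do rewrite big_cons; apply: differentiableCD.
Qed.

Lemma deriveC_sum I (r : seq I) (f : I -> V -> R[i]) x v :
  (forall i, differentiableC (f i) x) ->
  deriveC (fun y => \sum_(i <- r) f i y) x v = \sum_(i <- r) deriveC (f i) x v.
Proof.
move=> h; elim: r => [|i r IH].
  by rewrite big_nil; under eq_fun do rewrite big_nil; apply: deriveC_cst.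
rewrite big_cons; under eq_fun do rewrite big_cons.
by rewrite deriveCD ?IH //; apply: differentiableC_sum.
Qed.

Lemma differentiableC_cexp f x : differentiableC f x ->
  differentiableC (fun y => cexp (f y)) x.
Proof.
move=> [f1 f2].
have [he _] := diff_comp1 _ _ _ _ f1 (is_derive_expR _).
have [hc _] := diff_comp1 _ _ _ _ f2 (is_derive_cos _).
have [hs _] := diff_comp1 _ _ _ _ f2 (is_derive_sin _).
by apply: differentiableCM; split=> //=; apply: differentiable_cst.
Qed.

Lemma deriveC_cexp f x v : differentiableC f x ->
  deriveC (fun y => cexp (f y)) x v = cexp (f x) * deriveC f x v.
Proof.
move=> [f1 f2].
have [he1 he] := diff_comp1 _ _ _ _ f1 (is_derive_expR _).
have [hc1 hc] := diff_comp1 _ _ _ _ f2 (is_derive_cos _).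
have [hs1 hs] := diff_comp1 _ _ _ _ f2 (is_derive_sin _).
rewrite deriveCM; last by split.
  rewrite /deriveC /= /cexp; apply: complex_eq_ReIm; simpc => /=.
    rewrite (derive_cst 0) he hc ?hs; ring.
  rewrite (derive_cst 0) he ?hc hs; ring.
by split=> //=; apply: differentiable_cst.
Qed.

End ComplexSmooth.

                                             

(** * Exterior calculus on a vector space *)

Section FlatCalculus.
Context {R : realType} {V : normedModType R}.
Local Notation form := (multiform V R[i]).
Implicit Types (a b : V -> form) (x v : V) (vs : seq V).

(** The formula of [ext_d] in a fixed coordinate space, so that [ext_d] at a point is definitionally
    [flat_d] of the local form. *)
Definition flat_d a x : form := fun vs => \sum_(i < size vs)
  (-1) ^+ i * deriveC (fun y => a y (take i vs ++ drop i.+1 vs)) x (nth 0 vs i).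

Definition flat_D v a x : form := fun vs => deriveC (fun y => a y vs) x v.

Definition flat_differentiable a x := forall vs, differentiableC (fun y => a y vs) x.

                                                                                    
                                                                 
(** Cartan's formula for a constant field, whose Lie derivative is the directional derivative. The
    summand [i = 0] gives [flat_D]; the others are shifted by one place, hence the sign. *)
Lemma contr_flat_d a x v :
  contr v (flat_d a x) = flat_D v a x - flat_d (fun y => contr v (a y)) x.
Proof.
apply/funext => vs; rewrite /contr /flat_d /= big_ord_recl /=.
rewrite expr0 mul1r drop0 multiform_addE multiform_oppE; congr (_ + _).
by rewrite -sumrN; apply: eq_bigr => i _; rewrite /= exprS mulN1r mulNr.
Qed.

Lemma flat_d_congr a b x vs :
  (forall y us, (size us < size vs)%N -> a y us = b y us) ->
  flat_d a x vs = flat_d b x vs.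
Proof.
move=> h; rewrite /flat_d; apply: eq_bigr => i _.
suff -> : (fun y => a y (take i vs ++ drop i.+1 vs)) =
  (fun y => b y (take i vs ++ drop i.+1 vs)) by [].
apply/funext => y; apply: h.
by rewrite size_cat size_takel ?size_drop ?(ltnW (ltn_ord i)) //; case: i => i /=
  ?; lia.
Qed.

Lemma flat_differentiableM a b x : flat_differentiable a x ->
  flat_differentiable b x -> flat_differentiable (fun y => a y * b y) x.
Proof.
move=> ha hb vs; apply: differentiableC_sum => t.
apply: differentiableCM (hb _).
exact: differentiableCM (differentiableC_cst _ _) (ha _).
Qed.

Lemma flat_differentiable_cst (c : form) x : flat_differentiable (fun=> c) x.
Proof. by move=> vs; apply: differentiableC_cst. Qed.

Lemma flat_differentiable_sum I (r : seq I) (f : I -> V -> form) x :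
  (forall i, flat_differentiable (f i) x) ->
  flat_differentiable (fun y => \sum_(i <- r) f i y) x.
Proof.
move=> h vs; under eq_fun do rewrite multiform_sumE.
by apply: differentiableC_sum => i; apply: h.
Qed.

Lemma flat_differentiableX n a x : flat_differentiable a x ->
  flat_differentiable (fun y => a y ^+ n) x.
Proof.
move=> ha; elim: n => [|n IH]; first exact: flat_differentiable_cst.
by under eq_fun do rewrite exprS; apply: flat_differentiableM.
Qed.

Lemma flat_differentiable_scalar (f : V -> R[i]) x :
  differentiableC f x -> flat_differentiable (fun y => scalar_form (f y)) x.
Proof. by move=> hf [|v vs] //=; apply: differentiableC_cst. Qed.

Lemma flat_differentiable_parity a x :
  flat_differentiable a x -> flat_differentiable (fun y => parity (a y)) x.
Proof.
by move=> ha vs; apply: differentiableCM (ha _); apply: differentiableC_cst.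
Qed.

Lemma flat_DM v a b x : flat_differentiable a x -> flat_differentiable b x ->
  flat_D v (fun y => a y * b y) x = flat_D v a x * b x + a x * flat_D v b x.
Proof.
move=> ha hb; apply/funext => vs; rewrite /flat_D deriveC_sum; last first.
  move=> t; apply: differentiableCM (hb _).
  exact: differentiableCM (differentiableC_cst _ _) (ha _).
rewrite multiform_addE -!multiform_mulE /wedge -big_split /=.
apply: eq_bigr => t _.
have hat := differentiableCM _ _ _ (differentiableC_cst (shuffle_sign R[i] t) x)
  (ha (mask t vs)).
rewrite (deriveCM _ _ _ _ hat (hb _)).
rewrite (deriveCM _ _ _ _ (differentiableC_cst _ _) (ha _)).
by rewrite deriveC_cst mul0r add0r.
Qed.

Lemma flat_dD a b x : flat_differentiable a x -> flat_differentiable b x ->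
  flat_d (fun y => a y + b y) x = flat_d a x + flat_d b x.
Proof.
move=> ha hb; apply/funext => vs; rewrite multiform_addE -big_split /=.
by apply: eq_bigr => i _; rewrite deriveCD // mulrDr.
Qed.

Lemma flat_d_cst (c : form) x : flat_d (fun=> c) x = 0.
Proof.
by apply/funext => vs; apply: big1 => i _; rewrite deriveC_cst mulr0.
Qed.

Lemma flat_d_parity a x : flat_differentiable a x ->
  flat_d (fun y => parity (a y)) x = - parity (flat_d a x).
Proof.
move=> ha; apply/funext => vs; rewrite multiform_oppE /parity /flat_d mulr_sumr
  -sumrN.
apply: eq_bigr => i _; rewrite deriveCM; [|exact: differentiableC_cst|exact: ha].
rewrite deriveC_cst mul0r add0r.
have -> : (-1) ^+ size vs = - (-1) ^+ (size (take i vs ++ drop i.+1 vs)) :> R[i].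
  rewrite -[RHS]mulN1r -exprS; congr (_ ^+ _).
  rewrite size_cat size_takel ?size_drop ?(ltnW (ltn_ord i)) //.
  by case: i => i /= ?; lia.
by ring.
Qed.

(** Induction on the list. Contraction with its first vector reduces the claim, through Cartan's
    formula, to the product rules for [flat_D] and for contraction, and to the same claim for
    contracted factors on a shorter list. *)
Lemma flat_dM a b x : flat_differentiable a x -> flat_differentiable b x ->
  flat_d (fun y => a y * b y) x = flat_d a x * b x + parity (a x) * flat_d b x.
Proof.
move=> ha hb; apply/funext => vs.
elim: vs a b ha hb => [|v vs IH] a b ha hb.
  rewrite multiform_addE -!multiform_mulE !wedge_nil /flat_d /=.
  by rewrite !big_ord0 mul0r mulr0 addr0.
rewrite -[LHS]/(contr v _ vs) contr_flat_d flat_DM //.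
rewrite -[RHS]/(contr v _ vs) contrD !contrM !contr_flat_d.
have cv (a' : V -> form) : flat_differentiable a' x ->
  flat_differentiable (fun y => contr v (a' y)) x by move=> h us; apply: h.
have -> : (fun y => contr v (a y * b y)) =
    (fun y => contr v (a y) * b y + parity (a y) * contr v (b y)).
  by apply/funext => y; rewrite contrM.
rewrite flat_dD; [|exact: flat_differentiableM (cv _ ha) hb|
  exact: flat_differentiableM (flat_differentiable_parity _ _ ha) (cv _ hb)].
rewrite multiform_addE multiform_oppE multiform_addE.
rewrite (IH _ _ (cv _ ha) hb) (IH _ _ (flat_differentiable_parity _ _ ha) (cv _ hb)).
rewrite flat_d_parity // !parityK !contr_parity.
rewrite !(mulrDl, mulrDr, mulNr, mulrN) !(multiform_addE, multiform_oppE).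
ring.
Qed.

Lemma flat_d_sum m (f : 'I_m -> V -> form) x :
  (forall i, flat_differentiable (f i) x) ->
  flat_d (fun y => \sum_(i < m) f i y) x = \sum_(i < m) flat_d (f i) x.
Proof.
elim: m f => [|m IH] f h.
  rewrite big_ord0; under eq_fun do rewrite big_ord0; exact: flat_d_cst.
rewrite big_ord_recl; under eq_fun do rewrite big_ord_recl.
rewrite flat_dD //; first by rewrite IH.
exact: flat_differentiable_sum.
Qed.

Lemma flat_dZ k a x : flat_differentiable a x ->
  flat_d (fun y => k *: a y) x = k *: flat_d a x.
Proof.
move=> ha; under eq_fun do rewrite -mulr_algl.
rewrite (flat_dM _ _ _ (flat_differentiable_cst _ _) ha).
by rewrite flat_d_cst mul0r add0r parityZ parity1 mulr_algl.
Qed.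

Lemma flat_d_scalar_cexp (f : V -> R[i]) x : differentiableC f x ->
  flat_d (fun y => scalar_form (cexp (f y))) x =
  cexp (f x) *: flat_d (fun y => scalar_form (f y)) x.
Proof.
move=> hf; apply/funext => vs; rewrite multiform_scaleE /flat_d mulr_sumr.
apply: eq_bigr => i _; rewrite mulrCA; congr (_ * _).
case: (take i vs ++ drop i.+1 vs) => [|w ws] /=; first by rewrite deriveC_cexp.
by rewrite !deriveC_cst mulr0.
Qed.

End FlatCalculus.

(** * The Cartan differential of the exponential in coordinates *)

Section PowersOfEvenForms.
Context {R : realType} {V : Type}.
Local Notation form := (multiform V R[i]).
Implicit Types (a b : form) (v : V).

(** For even [a] the derivation rule reads $\iota_va^n=na^{n-1}\iota_va$, so the truncated series
    loses one term. *)
Lemma contr_texp v a m : parity a = a ->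
  contr v (texp m.+1 a) = texp m a * contr v a.
Proof.
move=> ha; have cX n : contr v (a ^+ n) = n%:R *: (a ^+ n.-1 * contr v a).
  elim: n => [|n IH]; first by rewrite scale0r.
  rewrite exprSr contrM IH parityX // -scalerAl -mulrA -(mul_evenC _ _ ha).
  case: n {IH} => [|n] /=; first by rewrite scale0r add0r scale1r.
  by rewrite mulrA -exprSr -[X in _ + X]scale1r -scalerDl natr1.
have contr_sum (r : seq 'I_m.+1) (f : 'I_m.+1 -> form) :
    contr v (\sum_(i <- r) f i) = \sum_(i <- r) contr v (f i).
  by apply: (big_morph (contr v)).
rewrite /texp contr_sum big_ord_recl contrZ cX scale0r scaler0 add0r mulr_suml.
apply: eq_bigr => i _; rewrite contrZ cX /= scalerA -scalerAl; congr (_ *: _).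
by rewrite factS natrM invfM mulrAC mulVf ?mul1r // pnatr_eq0.
Qed.

Lemma parity_texp a m : parity a = a -> parity (texp m a) = texp m a.
Proof.
move=> ha; rewrite /texp (big_morph parity parityD (_ : _ = 0)); last first.
  by apply/funext => vs; rewrite /parity mulr0.
by apply: eq_bigr => i _; rewrite parityZ parityX.
Qed.

Lemma texp_mul_congr a b m vs : vanishes 1 a -> (size vs < m)%N ->
  (mexp a * b) vs = (texp m a * b) vs.
Proof.
move=> ha hm; apply: mul_congr => // us hus.
by rewrite texp_mexp // (leq_ltn_trans hus).
Qed.

End PowersOfEvenForms.

Section FlatExponential.
Context {R : realType} {V : normedModType R}.
Local Notation form := (multiform V R[i]).
Variables (sigma kappa : V -> form) (c : V -> R[i]) (x v : V).
Hypotheses (dsigma : flat_differentiable sigma x)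
  (dkappa : flat_differentiable kappa x) (dc : differentiableC c x).
Hypotheses (sigma_even : parity (sigma x) = sigma x)
  (sigma_vanishes : forall y, vanishes 1 (sigma y)).
Hypotheses (dsigma_kappa : flat_d sigma x * kappa x = 0)
  (dc_kappa : flat_d (fun y => scalar_form (c y)) x * kappa x
              = contr v (sigma x) * kappa x)
  (contr_kappa : contr v (kappa x) = 0).

Let s := sigma x.

(** In $d\sigma\,\sigma^n\kappa$ the even power is commuted to the far side of $\kappa$, so that
    $d\sigma$ meets $\kappa$ and gives zero. *)
Let d_sigmaX n : flat_d (fun y => sigma y ^+ n) x * kappa x = 0.
Proof.
elim: n => [|n IH]; first by rewrite flat_d_cst mul0r.
under eq_fun do rewrite exprS.
rewrite (flat_dM _ _ _ dsigma (flat_differentiableX n _ _ dsigma)).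
rewrite mulrDl -!mulrA IH mulr0 addr0 (commX_even _ n _ sigma_even).
by rewrite mulrA dsigma_kappa mul0r.
Qed.

Let dX n : flat_differentiable (fun y => n`!%:R^-1 *: sigma y ^+ n) x.
Proof.
under eq_fun do rewrite -mulr_algl.
apply: flat_differentiableM (flat_differentiableX _ _ _ dsigma).
exact: flat_differentiable_cst.
Qed.

Let dtexp m : flat_differentiable (fun y => texp m (sigma y)) x.
Proof. by apply: flat_differentiable_sum => i; exact: dX. Qed.

Let d_texp m : flat_d (fun y => texp m (sigma y)) x * kappa x = 0.
Proof.
rewrite /texp flat_d_sum // mulr_suml big1 // => i _.
by rewrite flat_dZ ?d_sigmaX -?scalerAl ?d_sigmaX ?scaler0 //; apply:
  flat_differentiableX.
Qed.

(** The central computation, used with $\sigma=zs$ and $c=-z\nu_\xi$ in a chart. Terms in $d\sigma$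
    die against $\kappa$; the term in $dc$ turns into $e^\sigma\,\iota_v\sigma\,\kappa$, once the
    even exponential is moved aside, and cancels the contraction. A single vector [v] suffices
    because contraction is pointwise. *)
Lemma flat_cartan_mexp :
  let E y := cexp (c y) *: (mexp (sigma y) * kappa y) in
  flat_d E x - contr v (E x) = cexp (c x) *: (mexp s * flat_d kappa x).
Proof.
move=> E; apply/funext => vs; set m := (size vs).+1.
(* Contraction evaluates [E] on [v :: vs], of length [m]. The truncation must therefore reach the
   power [m], hence [texp m.+1]. *)
pose T y := scalar_form (cexp (c y)) * (texp m.+1 (sigma y) * kappa y).
have ET y us : (size us < m.+1)%N -> E y us = T y us.
  move=> hus; rewrite /T scalarE mulr_algl multiform_scaleE /E multiform_scaleE.
  by rewrite (texp_mul_congr _ _ m.+1).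
rewrite multiform_addE multiform_oppE (flat_d_congr E T); last first.
  by move=> y us hus; apply: ET; rewrite /m; lia.
rewrite [contr v (E x) vs](ET x (v :: vs)) // -[T x _]/(contr v (T x) vs).
rewrite multiform_scaleE (texp_mul_congr _ _ m.+1) //.
have dTk := flat_differentiableM _ _ _ (dtexp m.+1) dkappa.
rewrite /T flat_dM //; last first.
  by apply: flat_differentiable_scalar; apply: differentiableC_cexp.
rewrite flat_d_scalar_cexp // parity_scalar !scalarE !mulr_algl.
rewrite contrZ contrM contr_kappa mulr0 addr0 contr_texp // flat_dM //.
rewrite d_texp add0r parity_texp // -scalerAl.
have -> : flat_d (fun y => scalar_form (c y)) x * (texp m.+1 (sigma x) * kappa x)
   = texp m.+1 (sigma x) * (contr v (sigma x) * kappa x).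
  by rewrite mulrA -(mul_evenC _ _ (parity_texp _ m.+1 sigma_even)) -mulrA dc_kappa.
(* Contraction left [texp m] where the derivative left [texp m.+1]. The surplus term carries
   $\sigma^m$, which vanishes on [vs] because [vs] has length below [m]. *)
rewrite -mulrA multiform_addE !multiform_scaleE [texp m.+1 _ in X in X + _ -
  _]big_ord_recr /=.
rewrite -/(texp m s) mulrDl multiform_addE.
rewrite -scalerAl multiform_scaleE (vanishesM m 0 _ _ (vanishesX _ m
  (sigma_vanishes x))) //; last by rewrite addn0.
by rewrite mulr0 addr0 addrAC subrr add0r.
exact: sigma_vanishes.
Qed.

End FlatExponential.

                           

(** * Pullback, multilinearity and alternation at a point *)

Section Comap.
Context {V W : Type} {K : comNzRingType}.
Implicit Types (f : V -> W) (a b : multiform W K).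

Definition comap f a : multiform V K := fun vs => a [seq f v | v <- vs].

Lemma comapD f a b : comap f (a + b) = comap f a + comap f b.
Proof. by []. Qed.

Lemma comapZ f k a : comap f (k *: a) = k *: comap f a.
Proof. by []. Qed.

Lemma comap_parity f a : comap f (parity a) = parity (comap f a).
Proof. by apply/funext => vs; rewrite /comap /parity size_map. Qed.

Lemma comap_contr v f a : contr v (comap f a) = comap f (contr (f v) a).
Proof. by []. Qed.

Lemma comap_scalar f (k : K) : comap f (scalar_form k) = scalar_form k.
Proof. by apply/funext => -[|v vs]. Qed.

Lemma comapM f a b : comap f (a * b) = comap f a * comap f b.
Proof.
apply/funext => vs; elim: vs a b => [|v vs IH] a b.
  by rewrite /comap /= -!multiform_mulE !wedge_nil.
rewrite -[LHS]/(contr v (comap f (a * b)) vs) comap_contr contrM comapD.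
rewrite -[RHS]/(contr v (comap f a * comap f b) vs) contrM !comap_contr.
by rewrite -comap_parity !multiform_addE !IH.
Qed.

Lemma comapX f a n : comap f (a ^+ n) = comap f a ^+ n.
Proof.
elim: n => [|n IH]; last by rewrite !exprS comapM IH.
by rewrite !expr0; exact: comap_scalar.
Qed.

End Comap.

Lemma comap_mexp {R : realType} {V W : Type} (f : V -> W)
  (a : multiform W R[i]) : comap f (mexp a) = mexp (comap f a).
Proof.
apply/funext => vs; rewrite /comap /mexp size_map /texp !multiform_sumE.
by apply: eq_bigr => i _; rewrite !multiform_scaleE -comapX.
Qed.

Section Alternating.
Context {R : realType} {V : lmodType R}.
Implicit Types (a b : multiform V R[i]).

Definition multilinear a := forall us vs (k : R) (v w : V),
  a (us ++ (k *: v + w) :: vs) = k%:C * a (us ++ v :: vs) + a (us ++ w :: vs).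

Definition alternating a := forall us vs ws (v : V),
  a (us ++ v :: vs ++ v :: ws) = 0.

Lemma multilinear_contr u a : multilinear a -> multilinear (contr u a).
Proof. by move=> h us vs k v w; apply: (h (u :: us)). Qed.

Lemma multilinear_parity a : multilinear a -> multilinear (parity a).
Proof.
move=> h us vs k v w; rewrite /parity !size_cat /= h; ring.
Qed.

Lemma contr_linear k v w a : multilinear a ->
  contr (k *: v + w) a = k%:C *: contr v a + contr w a.
Proof. by move=> h; apply/funext => vs; exact: (h [::]). Qed.

Lemma multilinearM a b : multilinear a -> multilinear b -> multilinear (a * b).
Proof.
move=> + + us; elim: us a b => [|u us IH] a b ha hb vs k v w /=.
  have cE x : (a * b) (x :: vs) = contr x (a * b) vs by [].
  rewrite !cE !contrM !contr_linear //.
  rewrite mulrDl mulrDr -scalerAl -scalerAr !multiform_addE !multiform_scaleE.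
  ring.
have cE xs : (a * b) (u :: xs) = contr u (a * b) xs by [].
rewrite !cE contrM !multiform_addE.
rewrite (IH _ _ (multilinear_contr u a ha) hb).
rewrite (IH _ _ (multilinear_parity _ ha) (multilinear_contr u b hb)); ring.
Qed.

Lemma alternating_contr u a : alternating a -> alternating (contr u a).
Proof. by move=> h us; apply: (h (u :: us)). Qed.

Lemma alternating_parity a : alternating a -> alternating (parity a).
Proof. by move=> h us vs ws v; rewrite /parity h mulr0. Qed.

(** Expanding on $v+w$ in two neighbouring places shows that exchanging neighbours changes the sign;
    the first copy of [v] is walked in this way towards the second. *)
Lemma alternating_adjacent a : multilinear a ->
  (forall us v vs, a (us ++ v :: v :: vs) = 0) -> alternating a.
Proof.
move=> la ha us vs; elim: vs us => [|w vs IH] us ws v; first exact: ha.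
have hD us1 vs1 v1 w1 : a (us1 ++ (v1 + w1) :: vs1) =
    a (us1 ++ v1 :: vs1) + a (us1 ++ w1 :: vs1).
  by have := la us1 vs1 1 v1 w1; rewrite scale1r mul1r.
have := ha us (v + w) (vs ++ v :: ws); rewrite hD.
rewrite -(cat_rcons v us ((v + w) :: _)) -(cat_rcons w us ((v + w) :: _)) !hD
  !cat_rcons !ha add0r addr0 => /eqP.
rewrite addr_eq0 => /eqP ->; have := IH (rcons us w) ws v.
by rewrite cat_rcons => ->; rewrite oppr0.
Qed.

(** By the previous reduction only adjacent repetitions matter. Contracting twice with [v], the two
    mixed terms cancel because contraction anticommutes with [parity]. *)
Lemma alternatingM a b : multilinear a -> multilinear b ->
  alternating a -> alternating b -> alternating (a * b).
Proof.
move=> la lb ha hb; apply: alternating_adjacent; first exact: multilinearM.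
have cc v c : alternating c -> contr v (contr v c) = 0.
  by move=> h; apply/funext => vs; exact: (h [::] [::]).
move=> us v vs; elim: us a b ha hb {la lb} => [|u us IH] a b ha hb /=.
  rewrite -[LHS]/(contr v (contr v (a * b)) vs) contrM contrD !contrM !cc //.
  by rewrite mul0r mulr0 add0r addr0 contr_parity mulNr subrr.
rewrite -[LHS]/(contr u (a * b) (us ++ v :: v :: vs)) contrM multiform_addE.
rewrite (IH _ _ (alternating_contr u a ha) hb).
rewrite (IH _ _ (alternating_parity _ ha) (alternating_contr u b hb)); ring.
Qed.

End Alternating.

(** * Charts and differential forms on a manifold *)

Section Charts.
Context {R : realType} {M : manifold R}.
Implicit Types (i j : atlas_index M) (p q : M).

Definition chart_image i := chart_fun (atlas i) @` chart_dom (atlas i).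

Lemma chart_image_open i : open (chart_image i).
Proof. exact: chart_img_open. Qed.

Lemma chart_inv_dom i y : chart_image i y ->
  chart_dom (atlas i) (chart_inv (atlas i) y).
Proof. by move=> [q hq <-]; rewrite chart_funK. Qed.

Lemma chart_invK i y : chart_image i y ->
  chart_fun (atlas i) (chart_inv (atlas i) y) = y.
Proof. by move=> [q hq <-]; rewrite chart_funK. Qed.

Lemma pt_coord_image p : chart_image (chart_at p) (pt_coord p p).
Proof. by exists p => //; apply: chart_atP. Qed.

Lemma pt_coordK p : chart_inv (atlas (chart_at p)) (pt_coord p p) = p.
Proof. by rewrite chart_funK //; apply: chart_atP. Qed.

Lemma chart_image_preimage i (A : set M) : open A ->
  open [set y | chart_image i y /\ A (chart_inv (atlas i) y)].
Proof.
move=> oA; have /(@continuousP (subspace (chart_image i)) M) h :=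
  @chart_inv_cont _ _ _ (atlas i).
have /open_subspaceP[B oB AB] := h _ oA.
have -> : [set y | chart_image i y /\ A (chart_inv (atlas i) y)] = B `&`
  chart_image i.
  by rewrite AB; apply/seteqP; split=> y /= [].
by apply: openI oB _; apply: chart_image_open.
Qed.

(** Tangent vectors at [p] are already written in the chart [chart_at p], and the transition from
    this chart to itself is the identity near the point. *)
Lemma of_chart_pt p (v : tangent_space M) : of_chart (chart_at p) p v = v.
Proof.
have near_id : \forall y \near pt_coord p p,
    y = (pt_coord p \o chart_inv (atlas (chart_at p))) y.
  have : nbhs (pt_coord p p) (chart_image (chart_at p)).
    by apply: open_nbhs_nbhs; split; [exact: chart_image_open|exact: pt_coord_image].
  by apply: filterS => y hy /=; rewrite /pt_coord chart_invK.
have did := is_diff_id (pt_coord p p).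
have [_ h] := near_eq_diff id _ _ near_id (@ex_diff _ _ _ _ _ _ _ did).
by rewrite /of_chart -/(pt_coord p p) h diff_val.
Qed.

End Charts.

Section OmegaTotal.
Context {R : realType} {M : manifold R}.
Implicit Types (a b : dform M) (p : M) (i : atlas_index M).

Lemma local_formE i a y : local_form i a y =
  comap (of_chart i (chart_inv (atlas i) y)) (a (chart_inv (atlas i) y)).
Proof. by []. Qed.

Lemma local_form_pt p a : local_form (chart_at p) a (pt_coord p p) = a p.
Proof.
rewrite local_formE pt_coordK; apply/funext => vs; rewrite /comap map_id_in //.
by move=> v _; apply: of_chart_pt.
Qed.

Lemma ext_dE a p : ext_d a p = flat_d (local_form (chart_at p) a) (pt_coord p p).
Proof. by []. Qed.

Definition smooth_cfun (f : M -> R[i]) := forall i,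
  smooth_onC (chart_image i) (f \o chart_inv (atlas i)).

Lemma Omega_total_multilinear a p : Omega_total a -> multilinear (a p : multiform
  _ _).
Proof. by move=> h us vs k v w; apply: form_multilinear. Qed.

Lemma Omega_total_alternating a p : Omega_total a -> alternating (a p : multiform
  _ _).
Proof. by move=> h us vs ws v; apply: form_alternating. Qed.

Lemma Omega_total_differentiable a p : Omega_total a ->
  flat_differentiable (local_form (chart_at p) a) (pt_coord p p).
Proof.
move=> h vs; apply: (smooth_onC_differentiable (chart_image (chart_at p))).
  exact: (form_smooth h).
exact: pt_coord_image.
Qed.

Lemma smooth_cfun_differentiable f p : smooth_cfun f ->
  differentiableC (f \o chart_inv (atlas (chart_at p))) (pt_coord p p).
Proof.
by move=> h; apply: smooth_onC_differentiable (h _) _; apply: pt_coord_image.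
Qed.

Lemma Omega_totalM a b : Omega_total a -> Omega_total b ->
  Omega_total (fun p => (a p : multiform _ _) * b p).
Proof.
move=> ha hb; split=> [p|p|i vs].
- by apply: multilinearM; apply: Omega_total_multilinear.
- by apply: alternatingM; (apply: Omega_total_multilinear||apply:
  Omega_total_alternating).
have oU := chart_image_open i; have [_ _ sa] := ha; have [_ _ sb] := hb.
apply: (smooth_onC_ext _ (fun y => \sum_(t : (size vs).-tuple bool)
   shuffle_sign R[i] t * local_form i a y (mask t vs) *
   local_form i b y (mask (map negb t) vs)) _ oU).
  move=> y _; rewrite [RHS]/local_form.
  rewrite -[RHS]/(comap (of_chart i (chart_inv (atlas i) y))
    ((a (chart_inv (atlas i) y) : multiform _ _) * b (chart_inv (atlas i) y)) vs).
  by rewrite comapM.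
apply: smooth_onC_sum => // t; apply: smooth_onCM (sb i _) => //.
exact: smooth_onCM oU (smooth_onC_cst _ _) (sa i _).
Qed.

Lemma Omega_total_scalar f : smooth_cfun f ->
  Omega_total (fun p => scalar_form (f p)).
Proof.
move=> h; split=> [p us vs k v w|p us vs ws v|i vs].
- have z x : scalar_form (f p) (us ++ x :: vs) = 0 by case: us.
  by rewrite !z mulr0 addr0.
- by case: us.
case: vs => [|v vs]; last exact: (smooth_onC_cst _ 0).
exact: h.
Qed.

Lemma smooth_cfun_cst (c : R[i]) : smooth_cfun (fun=> c).
Proof. by move=> i; apply: smooth_onC_cst. Qed.

Lemma Omega_totalZ k a : Omega_total a ->
  Omega_total (fun p => k *: (a p : multiform _ _)).
Proof.
move=> ha; have := Omega_totalM _ _ (Omega_total_scalar _ (smooth_cfun_cst k)) ha.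
congr Omega_total.
by apply/funext => p; rewrite scalarE mulr_algl.
Qed.

Lemma Omega_total0 : Omega_total ((fun=> (0 : multiform _ _)) : dform M).
Proof.
split=> [p us vs k v w|p us vs ws v|i vs]; rewrite ?mulr0 ?addr0 //.
exact: (smooth_onC_cst _ 0).
Qed.

Lemma Omega_totalD a b : Omega_total a -> Omega_total b ->
  Omega_total (fun p => (a p : multiform _ _) + b p).
Proof.
move=> ha hb; split=> [p us vs k v w|p us vs ws v|i vs].
- rewrite !multiform_addE (form_multilinear ha) (form_multilinear hb); ring.
- by rewrite !multiform_addE (form_alternating ha) (form_alternating hb) addr0.
apply: smooth_onCD; [exact: chart_image_open|exact: (form_smooth ha)|].
exact: (form_smooth hb).
Qed.

Lemma Omega_total_sum m (f : 'I_m -> dform M) : (forall j, Omega_total (f j)) ->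
  Omega_total (fun p => \sum_(j < m) (f j p : multiform _ _)).
Proof.
elim: m f => [|m IH] f h.
  by under eq_fun do rewrite big_ord0; exact: Omega_total0.
under eq_fun do rewrite big_ord_recl.
by apply: Omega_totalD; last exact: IH.
Qed.

Lemma Omega_totalX n a : Omega_total a ->
  Omega_total (fun p => (a p : multiform _ _) ^+ n).
Proof.
move=> ha; elim: n => [|n IH].
  exact: (Omega_total_scalar _ (smooth_cfun_cst 1)).
by under eq_fun do rewrite exprS; apply: Omega_totalM.
Qed.

(** Each condition in [Omega_total] compares values on lists of one length, so it can be checked
    with a different form in every degree. This suits [mexp], whose truncation depends on the
    length. *)
Lemma Omega_total_stable (T : nat -> dform M) a :
  (forall m, Omega_total (T m)) ->
  (forall p vs, a p vs = T (size vs) p vs) -> Omega_total a.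
Proof.
move=> hT aT; split=> [p us vs k v w|p us vs ws v|i vs].
- by rewrite !aT (form_multilinear (hT _)) !size_cat /=.
- by rewrite aT (form_alternating (hT _)).
have -> : (fun y => local_form i a y vs) = (fun y => local_form i (T (size vs)) y vs).
  by apply/funext => y; rewrite /local_form aT size_map.
exact: (form_smooth (hT _)).
Qed.

End OmegaTotal.

(** * Pullback of forms along a smooth map *)

Lemma near_diff_comp {R : realType} {U V W : normedModType R} (f : U -> V)
    (g : V -> W) (h : U -> W) x v :
  differentiable f x -> differentiable g (f x) ->
  (\forall y \near x, g (f y) = h y) -> 'd g (f x) ('d f x v) = 'd h x v.
Proof.
move=> df dg gh.
have [_ ->] := near_eq_diff (g \o f) h x gh (differentiable_comp df dg).
by rewrite (diff_comp df dg).
Qed.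

Lemma eq_map_comp {T U U' W : Type} (f : U -> W) (g : T -> U) (f' : U' -> W)
    (g' : T -> U') (s : seq T) : (forall x, f (g x) = f' (g' x)) ->
  [seq f y | y <- [seq g x | x <- s]] = [seq f' y | y <- [seq g' x | x <- s]].
Proof. by move=> h; elim: s => //= x s ->; rewrite h. Qed.

Section Pullback.
Context {R : realType} {M N : manifold R} (F : M -> N).
Hypothesis F_smooth : smooth_map F.
Implicit Types (i : atlas_index M) (j : atlas_index N).

Definition chart_overlap i j :=
  [set y | chart_image i y /\ (F @^-1` chart_dom (atlas j)) (chart_inv (atlas i) y)].

Lemma chart_overlapE i j : chart_overlap i j =
  chart_fun (atlas i) @` (chart_dom (atlas i) `&` (F @^-1` chart_dom (atlas j))).
Proof.
apply/seteqP; split=> [_ [[q hq <-] hy]|_ [q [hq hF] <-]].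
  by exists q => //; split=> //; rewrite chart_funK in hy.
by split; [exists q|rewrite chart_funK].
Qed.

Lemma chart_overlap_open i j : open (chart_overlap i j).
Proof.
apply: chart_image_preimage; apply: open_comp; last exact: chart_dom_open.
by move=> x _; apply: F_smooth.1.
Qed.

Definition chart_map i j := chart_fun (atlas j) \o F \o chart_inv (atlas i).

Lemma chart_map_smooth i j : smooth_on (chart_overlap i j) (chart_map i j).
Proof. by rewrite chart_overlapE; apply: F_smooth.2. Qed.

Lemma chart_map_diff i j y :
  chart_overlap i j y -> differentiable (chart_map i j) y.
Proof. exact: (chart_map_smooth i j 1%N).1. Qed.

Lemma transition_diff (X : manifold R) (i j : atlas_index X) q :
  chart_dom (atlas i) q -> chart_dom (atlas j) q ->
  differentiable (chart_fun (atlas j) \o chart_inv (atlas i)) (chart_fun (atlas i) q).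
Proof. by move=> qi qj; apply: (atlas_smooth i j 1%N).1; exists q. Qed.

                                                                                  
                               
(** By the chain rule both sides are the differential at [y] of [F] read from the chart [i] into the
    chart chosen at [F q]; the intermediate charts cancel near [y]. *)
Lemma tangent_map_chart i j y v : chart_overlap i j y ->
  let q := chart_inv (atlas i) y in
  tangent_map F q (of_chart i q v) = of_chart j (F q) ('d (chart_map i j) y v).
Proof.
move=> hy q; have qi : chart_dom (atlas i) q by apply: chart_inv_dom hy.1.
have qj : chart_dom (atlas j) (F q) := hy.2.
have yE : chart_fun (atlas i) q = y by apply: chart_invK hy.1.
pose h := pt_coord (F q) \o F \o chart_inv (atlas i).
transitivity ('d h y v).
  rewrite /tangent_map /of_chart yE.
  pose f := pt_coord q \o chart_inv (atlas i).
  have fy : f y = pt_coord q q by [].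
  rewrite -fy; apply: near_diff_comp.
  - by rewrite -yE; apply: transition_diff => //; apply: chart_atP.
  - rewrite fy; apply: (chart_map_diff (chart_at q) (chart_at (F q))).
    split; first exact: pt_coord_image.
    by rewrite /= pt_coordK; apply: chart_atP.
  have o : open [set y | chart_image i y /\
      chart_dom (atlas (chart_at q)) (chart_inv (atlas i) y)].
    by apply: chart_image_preimage; apply: chart_dom_open.
  have : nbhs y [set y | chart_image i y /\
      chart_dom (atlas (chart_at q)) (chart_inv (atlas i) y)].
    by apply: open_nbhs_nbhs; split=> //; split; [exact: hy.1|exact: chart_atP].
  apply: filterS => w [_ hw]; rewrite /h /f /= /pt_uncoord /pt_coord.
  by rewrite (chart_funK hw).
rewrite /of_chart.
have -> : chart_fun (atlas j) (F q) = chart_map i j y by [].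
apply/esym; apply: near_diff_comp; first exact: chart_map_diff.
  by apply: transition_diff => //; apply: chart_atP.
have : nbhs y (chart_overlap i j).
  by apply: open_nbhs_nbhs; split=> //; apply: chart_overlap_open.
by apply: filterS => w [_ hw]; rewrite /h /chart_map /= (chart_funK hw).
Qed.

Lemma local_form_pullback i j (a : dform N) y vs : chart_overlap i j y ->
  local_form i (form_pullback F a) y vs =
  local_form j a (chart_map i j y) [seq 'd (chart_map i j) y v | v <- vs].
Proof.
move=> hy; pose q := chart_inv (atlas i) y.
have Fq : chart_inv (atlas j) (chart_map i j y) = F q.
  by apply: chart_funK; exact: hy.2.
have vsE : [seq tangent_map F q v | v <- [seq of_chart i q v | v <- vs]] =
    [seq of_chart j (F q) v | v <- [seq 'd (chart_map i j) y v | v <- vs]].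
  by apply: eq_map_comp => v; exact: (tangent_map_chart i j y v hy).
rewrite /local_form Fq -vsE; reflexivity.
Qed.

Lemma multilinear_comap {V W : lmodType R} (f : V -> W) (a : multiform W R[i]) :
  linear f -> multilinear a -> multilinear (comap f a).
Proof.
by move=> hf ha us vs k v w; rewrite /comap !map_cat /= hf ha.
Qed.

Lemma alternating_comap {V W : lmodType R} (f : V -> W) (a : multiform W R[i]) :
  alternating a -> alternating (comap f a).
Proof. by move=> ha us vs ws v; rewrite /comap !(map_cat, map_cons) ha. Qed.

Lemma multilinear_sum {V : lmodType R} (a : multiform V R[i]) n (k : 'I_n -> R)
    (e : 'I_n -> V) us vs : multilinear a ->
  a (us ++ (\sum_(l < n) k l *: e l) :: vs) =
  \sum_(l < n) (k l)%:C * a (us ++ e l :: vs).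
Proof.
move=> ha; elim: n k e => [|n IH] k e.
  rewrite !big_ord0; have := ha us vs 0 0 0.
  by rewrite scale0r addr0 mul0r add0r => h; have := ha us vs (-1) 0 0;
    rewrite scaler0 addr0 rmorphN rmorph1 mulN1r addNr.
by rewrite !big_ord_recl ha IH.
Qed.

Lemma Omega_total_pullback (a : dform N) :
  Omega_total a -> Omega_total (form_pullback F a).
Proof.
move=> ha; split=> [p|p|i vs].
- apply: multilinear_comap (Omega_total_multilinear _ _ ha); exact: linearP.
- exact: alternating_comap (Omega_total_alternating _ _ ha).
apply: smooth_onC_local => y0 hy0.
pose j := chart_at (F (chart_inv (atlas i) y0)).
have oA := chart_overlap_open i j.
exists (chart_overlap i j); split; first by split=> //; exact: chart_atP.
(* The image vectors vary with [y]. They are expanded one at a time in the standard basis, with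
   smooth coefficients, and the prefix [us] collects the constant vectors obtained so far. *)
suff h us : smooth_onC (chart_overlap i j) (fun y =>
    local_form j a (chart_map i j y) (us ++ [seq 'd (chart_map i j) y v | v <- vs])).
  apply: smooth_onC_ext oA _ (h [::]) => y hy.
  by rewrite (local_form_pullback i j).
have smooth_a ws := form_smooth ha j ws.
elim: vs us => [|v vs IH] us.
  under eq_fun do rewrite /= cats0.
  apply: smooth_onC_comp oA _ (chart_map_smooth i j) (smooth_a us) => y hy.
  by exists (F (chart_inv (atlas i) y)); [exact: hy.2|].
have h : smooth_onC (chart_overlap i j) (fun y => \sum_(l < mdim N)
    ('D_v (chart_map i j) y 0 l)%:C * local_form j a (chart_map i j y)
      (us ++ delta_mx 0 l :: [seq 'd (chart_map i j) y v | v <- vs])).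
  apply: smooth_onC_sum => // l; apply: smooth_onCM => //.
    apply: smooth_onC_real => k; apply: C_k_coord => //.
    exact: (chart_map_smooth i j k.+1).2.
  by have := IH (rcons us (delta_mx 0 l)); under eq_fun do rewrite cat_rcons.
apply: smooth_onC_ext oA _ h => y hy.
rewrite /= -(deriveE v (chart_map_diff _ _ _ hy)).
rewrite [in RHS](row_sum_delta ('D_v (chart_map i j) y)).
rewrite (multilinear_sum (local_form j a (chart_map i j y))) //.
rewrite local_formE; apply: multilinear_comap (Omega_total_multilinear _ _ ha).
exact: linearP.
Qed.

(** A function is a form of degree zero, and composition with [F] is its pullback. *)
Lemma smooth_cfun_comp (f : N -> R[i]) : smooth_cfun f -> smooth_cfun (f \o F).
Proof.
move=> /Omega_total_scalar /Omega_total_pullback hf i.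
exact: (form_smooth hf i [::]).
Qed.

End Pullback.

                                       

(** * Exponential forms on a manifold *)

Lemma parity_mexp {R : realType} {V : Type} (a : multiform V R[i]) :
  parity a = a -> parity (mexp a) = mexp a.
Proof.
move=> ha; apply/funext => vs.
by rewrite -[LHS]/(parity (texp (size vs).+1 a) vs) parity_texp.
Qed.

(** The multinomial expansion without grouping of repeated indices, which is how [sym_forms] writes
    homogeneous polynomials. *)
Lemma expr_sum_tuple {K : comNzRingType} (I : finType) (f : I -> K) n :
  (\sum_i f i) ^+ n = \sum_(t : n.-tuple I) \prod_(l < n) f (tnth t l).
Proof.
rewrite -[in LHS](card_ord n) -prodr_const bigA_distr_bigA.
rewrite (reindex (fun t : n.-tuple I => [ffun l => tnth t l])) /=.
  by apply: eq_bigr => t _; apply: eq_bigr => l _; rewrite ffunE.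
exists (fun h : {ffun 'I_n -> I} => mktuple h) => [t _|h _].
  by apply: eq_from_tnth => l; rewrite tnth_mktuple ffunE.
by apply/ffunP => l; rewrite ffunE tnth_mktuple.
Qed.

Section ExponentialForms.
Context {R : realType} {X : manifold R}.
Implicit Types (sigma kappa : dform X) (nu : X -> R) (z : R[i]) (p : X).

(** The value of $e^{z(\sigma-\nu)}\wedge\kappa$ with the scalar part of the exponent split off. It
    serves $N$ with $s,\kappa_1,\nu_\xi$ and $M$ with $F^*s,\kappa_2,\nu_\xi\circ F$. *)
Definition exp_form z sigma kappa nu : dform X := fun p =>
  cexp (- z * (nu p)%:C) *: (mexp (z *: (sigma p : multiform _ _)) * kappa p).

(** At [p] the exponent is a multiple of the unit plus an element without scalar part, and
    [wedge_power] is the power in the algebra, so the limit is the one of [mexp_cvg]. *)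
Lemma form_expE z sigma nu p : vanishes 1 (sigma p : multiform _ _) ->
  form_exp (form_scale z (sigma - form_of_fun nu)) p =
  cexp (- z * (nu p)%:C) *: mexp (z *: (sigma p : multiform _ _)).
Proof.
move=> hs; apply/funext => vs; apply: cvgC_lim.
rewrite multiform_scaleE; set a := z *: _.
have ha : vanishes 1 a by move=> us hus; rewrite /a multiform_scaleE hs ?mulr0.
have gE : form_scale z (sigma - form_of_fun nu) p = (- z * (nu p)%:C)%:A + a.
  apply/funext => us; rewrite -scalarE multiform_addE [RHS]addrC.
  transitivity (z * (sigma p us - form_of_fun nu p us)); first by [].
  by rewrite mulrBr mulNr; case: us => [|u us] //=; rewrite mulr0 oppr0.
have pE n : wedge_power (form_scale z (sigma - form_of_fun nu)) n p =
    ((- z * (nu p)%:C)%:A + a) ^+ n.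
  elim: n => [|n IH]; first by apply/funext => -[|u us].
  by rewrite exprS -IH -gE.
under eq_fun => m do under eq_bigr => n _ do rewrite pE.
exact: mexp_cvg.
Qed.

Lemma smooth_cfun_real nu : smooth_fun nu -> smooth_cfun (fun p => (nu p)%:C).
Proof. by move=> h i; apply: smooth_onC_real (h i). Qed.

Lemma smooth_cfun_cexp z nu : smooth_cfun (fun p => (nu p)%:C) ->
  smooth_cfun (fun p => cexp (z * (nu p)%:C)).
Proof.
move=> h i; apply: (smooth_onC_cexp _ (fun y => z * (nu (chart_inv (atlas i) y))%:C)).
  exact: chart_image_open.
by apply: smooth_onCM (smooth_onC_cst _ z) (h i); apply: chart_image_open.
Qed.

Lemma Omega_total_mexp z sigma kappa : Omega_total sigma -> Omega_total kappa ->
  (forall p, vanishes 1 (sigma p : multiform _ _)) ->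
  Omega_total (fun p => mexp (z *: (sigma p : multiform _ _)) * (kappa p :
    multiform _ _)).
Proof.
move=> hs hk vs; apply: (Omega_total_stable (fun m p =>
    texp m.+1 (z *: (sigma p : multiform _ _)) * (kappa p : multiform _ _))).
  move=> m; apply: Omega_totalM hk.
  apply: (Omega_total_sum m.+1 (fun j p => j`!%:R^-1 *: (z *: (sigma p :
    multiform _ _)) ^+ j)).
  by move=> j; apply/Omega_totalZ/Omega_totalX/Omega_totalZ.
move=> p us; apply: texp_mul_congr => // ws hws.
by rewrite multiform_scaleE vs ?mulr0.
Qed.

Lemma Omega_total_exp_form z sigma kappa nu : Omega_total sigma -> Omega_total
  kappa ->
  (forall p, vanishes 1 (sigma p : multiform _ _)) ->
  smooth_cfun (fun p => (nu p)%:C) ->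
  Omega_total (exp_form z sigma kappa nu).
Proof.
move=> hs hk vs hn.
have := Omega_totalM _ _ (Omega_total_scalar _ (smooth_cfun_cexp (- z) _ hn))
  (Omega_total_mexp z _ _ hs hk vs).
by congr Omega_total; apply/funext => p; rewrite scalarE mulr_algl.
Qed.

Lemma ext_dM (a b : dform X) p : Omega_total a -> Omega_total b ->
  ext_d (form_wedge a b) p =
  (ext_d a p : multiform _ _) * b p + parity (a p) * (ext_d b p : multiform _ _).
Proof.
move=> ha hb; rewrite ext_dE.
have -> : local_form (chart_at p) (form_wedge a b) = fun y =>
    (local_form (chart_at p) a y : multiform _ _) * local_form (chart_at p) b y.
  apply/funext => y; exact: comapM.
rewrite flat_dM; [|exact: Omega_total_differentiable..].
by rewrite !local_form_pt.
Qed.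

(** [flat_cartan_mexp] read in the chart at [p]. The vector field enters through its value at [p]
    alone, where local forms coincide with the forms themselves. *)
Lemma ext_d_exp_form (v : vector_field X) z sigma kappa nu :
  Omega_total sigma -> Omega_total kappa -> smooth_cfun (fun p => (nu p)%:C) ->
  (forall p, vanishes 1 (sigma p : multiform _ _)) ->
  (forall p, parity (sigma p : multiform _ _) = sigma p) ->
  (forall p, (ext_d sigma p : multiform _ _) * kappa p = 0) ->
  (forall p, (ext_d (form_of_fun nu) p : multiform _ _) * kappa p =
     - (contr (v p) (sigma p) * (kappa p : multiform _ _))) ->
  (forall p, contr (v p) (kappa p) = 0) ->
  forall p, (ext_d (exp_form z sigma kappa nu) p : multiform _ _)
    - contr (v p) (exp_form z sigma kappa nu p) =
  cexp (- z * (nu p)%:C) *: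
    (mexp (z *: (sigma p : multiform _ _)) * (ext_d kappa p : multiform _ _)).
Proof.
move=> hs hk hn vs ps dsk dnk vk p; set i := chart_at p; set x := pt_coord p p.
pose sigma' y := z *: (local_form i sigma y : multiform _ _).
pose c y := - z * (nu (chart_inv (atlas i) y))%:C.
pose kappa' y : multiform (tangent_space X) R[i] := local_form i kappa y.
pose E y := cexp (c y) *: (mexp (sigma' y) * kappa' y).
have EE : local_form i (exp_form z sigma kappa nu) = E.
  apply/funext => y; rewrite local_formE /exp_form comapZ comapM comap_mexp.
  by rewrite comapZ.
have dk : flat_differentiable kappa' x by exact: Omega_total_differentiable.
have kx : kappa' x = kappa p := local_form_pt p kappa.
have ds : flat_differentiable sigma' x.
  move=> us; apply: differentiableCM (differentiableC_cst _ _) _.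
  exact: Omega_total_differentiable.
have dnu := smooth_cfun_differentiable _ p hn.
have dc : differentiableC c x := differentiableCM _ _ _ (differentiableC_cst _ _) dnu.
have dS : flat_d sigma' x = z *: (ext_d sigma p : multiform _ _).
  by rewrite /sigma' flat_dZ //; apply: Omega_total_differentiable.
have dC : flat_d (fun y => scalar_form (c y)) x = - z *: (ext_d (form_of_fun nu)
  p : multiform _ _).
  have hl : local_form i (form_of_fun nu) =
      fun y => scalar_form ((nu (chart_inv (atlas i) y))%:C).
    by apply/funext => y; apply/funext => -[|u us].
  rewrite ext_dE hl -flat_dZ; last exact: flat_differentiable_scalar.
  have -> // : (fun y => scalar_form (c y) : multiform (tangent_space X) _) = fun y =>
      - z *: scalar_form ((nu (chart_inv (atlas i) y))%:C).
  apply/funext => y; apply/funext => us; rewrite multiform_scaleE.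
  by case: us => [|u us] //=; rewrite mulr0.
have sx : sigma' x = z *: (sigma p : multiform _ _) by rewrite /sigma' local_form_pt.
have fE : flat_d E x - contr (v p) (E x) =
    cexp (c x) *: (mexp (sigma' x) * flat_d kappa' x).
  apply: flat_cartan_mexp => //.
  - by rewrite sx parityZ ps.
  - move=> y us hus; transitivity (z * local_form i sigma y us); first by [].
    by rewrite local_formE /comap vs ?mulr0 ?size_map.
  - by rewrite dS kx -scalerAl dsk scaler0.
  - rewrite dC sx kx contrZ -!scalerAl dnk.
    by rewrite scaleNr scalerN opprK.
  - by rewrite kx.
have Ex : E x = exp_form z sigma kappa nu p by rewrite -EE local_form_pt.
rewrite ext_dE EE -Ex fE sx /c /x pt_coordK; reflexivity.
Qed.

End ExponentialForms.

(** Powers are exchanged by $b^{n+1}c=b^nac=ab^nc=a^{n+1}c$, the even [a] being moved past $b^n$.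
    With $a=zg^*s$, $b=zs$ and $c=\kappa$ it turns invariance of $s\wedge\kappa$ into invariance of
    $e^{zs}\wedge\kappa$. *)
Lemma mexp_mul_eq {R : realType} {V : Type} (a b c : multiform V R[i]) :
  vanishes 1 a -> vanishes 1 b -> parity a = a ->
  a * c = b * c -> mexp a * c = mexp b * c.
Proof.
move=> va vb pa abc.
have X n : a ^+ n * c = b ^+ n * c.
  elim: n => [|n IH]; first by rewrite !expr0.
  by rewrite [in RHS]exprSr -mulrA -abc mulrA -(mul_evenC _ _ pa) -mulrA -IH
    mulrA -exprS.
have texpX m : texp m a * c = texp m b * c.
  rewrite [LHS]mulr_suml [RHS]mulr_suml; apply: eq_bigr => i _.
  by rewrite -[LHS]scalerAl -[RHS]scalerAl X.
apply/funext => vs; transitivity ((texp (size vs).+1 a * c) vs).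
  exact: texp_mul_congr.
by rewrite texpX; apply/esym; exact: texp_mul_congr.
Qed.

(** * Membership in the Cartan model *)

Section CartanExponential.
Context {R : realType} {G : lie_group R} {X : manifold R} (a : lie_action G X).
Variables (z : R[i]) (sigma kappa : dform X) (nu : X -> lie_alg G -> R).
Hypotheses (sigma_total : Omega_total sigma) (kappa_total : Omega_total kappa).
Hypothesis sigma_vanishes : forall p, vanishes 1 (sigma p : multiform _ _).
Hypothesis sigma_even : forall p, parity (sigma p : multiform _ _) = sigma p.
Hypothesis nu_linear : forall p (k : R) xi zeta,
  nu p (k *: xi + zeta) = k * nu p xi + nu p zeta.
Hypothesis nu_smooth : forall xi, smooth_cfun (fun p => (nu p xi)%:C).
Hypothesis kappa_invariant : forall g, form_pullback (a g) kappa = kappa.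
Hypothesis sigma_invariant : forall g,
  form_pullback (a g) (form_wedge sigma kappa) = form_wedge sigma kappa.
Hypothesis nu_equivariant : forall g xi,
  form_pullback (a g) (form_wedge (form_of_fun (fun p => nu p (Ad g xi))) kappa) =
  form_wedge (form_of_fun (fun p => nu p xi)) kappa.

Let nu_sum p (xi : 'rV[R]_(mdim G)) :
  nu p xi = \sum_(i < mdim G) xi 0 i * nu p (delta_mx 0 i : 'rV[R]_(mdim G)).
Proof.
rewrite [in LHS](row_sum_delta xi); elim/big_ind2 : _ => //.
- have := nu_linear p (-1) 0 0; rewrite scaler0 addr0 mulN1r => ->.
  by rewrite addNr.
- by move=> c r d t <- <-; have := nu_linear p 1 r t; rewrite scale1r mul1r.
move=> i _; have := nu_linear p (xi 0 i) (delta_mx 0 i) 0; rewrite addr0 => ->.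
have := nu_linear p (-1) 0 0; rewrite scaler0 addr0 mulN1r => ->.
by rewrite addNr addr0.
Qed.

Let K : dform X := fun p =>
  mexp (z *: (sigma p : multiform _ _)) * (kappa p : multiform _ _).

(** All dependence on [xi] sits in the scalar factor, so the term of order [n] is $(-z\nu_\xi)^n/n!$
    times the fixed form [K]. *)
Lemma cartan_analytic_exp : exists P : nat -> lie_alg G -> dform X,
  (forall n, sym_forms n (P n)) /\
  forall xi p vs, cvgC (fun m => \sum_(n < m) P n xi p vs)
    (exp_form z sigma kappa (fun p => nu p xi) p vs).
Proof.
exists (fun n xi p => n`!%:R^-1 *: ((- z * (nu p xi)%:C) ^+ n *: (K p : multiform
  _ _))).
split=> [n|xi p vs]; last first.
  under eq_fun => m do under eq_bigr => n _ do rewrite !multiform_scaleE mulrA.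
  under eq_fun => m do rewrite -mulr_suml.
  exact: cvgCM (cexp_cvg _) (cvgC_cst _).
pose e i : lie_alg G := delta_mx 0 i : 'rV[R]_(mdim G).
(* The coefficients come from expanding the power of $\nu_\xi=\sum_i\xi_i\nu_{e_i}$: the tuple [t]
   lists the chosen basis vectors. *)
exists (fun t p => scalar_form (n`!%:R^-1 * (- z) ^+ n *
  \prod_(l < n) (nu p (e (tnth t l)))%:C) * (K p : multiform _ _)); split=> [t|xi
    p vs].
  apply: Omega_totalM; last exact: Omega_total_mexp.
  apply: Omega_total_scalar => i; have oU := chart_image_open i.
  apply: smooth_onCM => //; first exact: smooth_onC_cst.
  by apply: smooth_onC_prod => // l; apply: nu_smooth.
under [RHS]eq_bigr => t _ do rewrite -multiform_mulE wedge_scalarl.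
rewrite !multiform_scaleE exprMn nu_sum rmorph_sum expr_sum_tuple.
move: (K p vs) => c.
rewrite mulr_sumr mulr_suml mulr_sumr; apply: eq_bigr => t _.
under eq_bigr => l _ do rewrite rmorphM.
rewrite big_split /= rmorph_prod; ring.
Qed.

(** Invariance is available for $\kappa$, $\sigma\wedge\kappa$ and $\nu\kappa$. The pulled-back
    $\sigma$ is exchanged for $\sigma$ inside the exponential by [mexp_mul_eq]; the scalar $\nu$ is
    treated by cancelling $\kappa$ pointwise. *)
Lemma cartan_exp_form : cartan a (fun xi => exp_form z sigma kappa (fun p => nu p
  xi)).
Proof.
split=> [xi||g xi]; [|exact: cartan_analytic_exp|].
  exact: Omega_total_exp_form.
apply/funext => p; set T := tangent_map (a g) p.
pose cT (b : dform X) := comap T (b (a g p)).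
have kE : cT kappa = kappa p by rewrite -[in RHS](kappa_invariant g).
have sE : cT sigma * (kappa p : multiform _ _) = (sigma p : multiform _ _) * kappa p.
  have h : comap T ((sigma (a g p) : multiform _ _) * kappa (a g p)) =
    (sigma p : multiform _ _) * kappa p := congr1 (@^~ p) (sigma_invariant g).
  by rewrite -h comapM -/(cT kappa) kE.
have nE : (nu (a g p) (Ad g xi))%:C *: (kappa p : multiform _ _) =
    (nu p xi)%:C *: (kappa p : multiform _ _).
  have h : comap T (scalar_form (nu (a g p) (Ad g xi))%:C * (kappa (a g p) :
    multiform _ _))
    = scalar_form (nu p xi)%:C * (kappa p : multiform _ _) :=
    congr1 (@^~ p) (nu_equivariant g xi).
  have sc (k : R[i]) (b : multiform (tangent_space X) R[i]) : k *: b =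
    scalar_form k * b.
    by rewrite scalarE mulr_algl.
  by rewrite !sc -h comapM comap_scalar -/(cT kappa) kE.
pose c' := - z * (nu (a g p) (Ad g xi))%:C.
have pullE : cT (exp_form z sigma kappa (fun p => nu p (Ad g xi))) =
    cexp c' *: (mexp (z *: cT sigma) * (kappa p : multiform _ _)).
  by rewrite -kE /cT /exp_form comapZ comapM comap_mexp comapZ.
have mE : mexp (z *: cT sigma) * (kappa p : multiform _ _) =
    mexp (z *: (sigma p : multiform _ _)) * kappa p.
  apply: mexp_mul_eq.
  - by move=> us hus; rewrite multiform_scaleE /cT /comap sigma_vanishes ?mulr0
    ?size_map.
  - by move=> us hus; rewrite multiform_scaleE sigma_vanishes ?mulr0.
  - by rewrite parityZ /cT -comap_parity sigma_even.
  by rewrite -[LHS]scalerAl -[RHS]scalerAl sE.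
transitivity (cexp c' *: (mexp (z *: (sigma p : multiform _ _)) * kappa p)).
  by rewrite -mE -pullE.
rewrite /exp_form /c'; move: (mexp _) => m.
                                                                                 
(* [nE] compares two scalars through their multiples of $\kappa(p)$. If $\kappa(p)=0$, both sides of
   the goal are zero; otherwise the scalars coincide. *)
have [k0|k0] := eqVneq (kappa p : multiform _ _) 0.
  by rewrite k0 !mulr0 !scaler0.
suff -> : (nu (a g p) (Ad g xi))%:C = (nu p xi)%:C :> R[i] by [].
apply/eqP; rewrite -subr_eq0; apply: contraNT k0 => h.
have h0 : ((nu (a g p) (Ad g xi))%:C - (nu p xi)%:C) *: (kappa p : multiform _ _) = 0.
  by rewrite scalerBl nE subrr.
have := scaler_eq0 ((nu (a g p) (Ad g xi))%:C - (nu p xi)%:C : R[i]) (kappa p :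
  multiform _ _).
by rewrite h0 eqxx (negPf h) => /esym.
Qed.

End CartanExponential.

(** * Two-forms and the relative module action *)

Section TwoForms.
Context {R : realType} {X : manifold R}.
Implicit Types (s : dform X) (p : X).

Lemma Omega2_vanishes s p : Omega 2 s -> vanishes 1 (s p : multiform _ _).
Proof. by move=> [_ h _] [|v vs] // _; apply: h. Qed.

Lemma Omega2_even s p : Omega 2 s -> parity (s p : multiform _ _) = s p.
Proof.
move=> [_ h _]; apply/funext => vs; rewrite /parity.
have [h2|h2] := eqVneq (size vs) 2; first by rewrite h2 sqrrN expr1n mul1r.
by rewrite h ?mulr0 //; apply: contra h2 => /eqP[->].
Qed.

End TwoForms.

Section RelativeForms.
Context {R : realType} {M N : manifold R} (F : M -> N).
Implicit Types (gamma : dform N) (nu : N -> R) (z : R[i]).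

Lemma form_pullback_even gamma :
  (forall p, parity (gamma p : multiform _ _) = gamma p) ->
  form_pullback F (form_parity gamma) = form_pullback F gamma.
Proof.
move=> h; have -> // : form_parity gamma = gamma.
by apply/funext => p; exact: h.
Qed.

Lemma rel_act_fun nu (a : rel_form M N) :
  rel_act F (form_of_fun nu) a =
  (form_wedge (form_of_fun nu) a.1, form_wedge (form_of_fun (nu \o F)) a.2).
Proof.
congr (_, form_wedge _ _); rewrite form_pullback_even => [|p].
  by apply/funext => p; apply/funext => -[|v vs].
by apply/funext => -[|v vs]; rewrite /parity /= ?mul1r ?mulr0.
Qed.

(** The exponential of an even form is even, so the action carries no sign, and pullback along [F]
    commutes with the exponential. *)
Lemma rel_act_exp z (s : dform N) nu (kappa : rel_form M N) : Omega 2 s ->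
  rel_act F (form_exp (form_scale z (s - form_of_fun nu))) kappa =
  (exp_form z s kappa.1 nu, exp_form z (form_pullback F s) kappa.2 (nu \o F)).
Proof.
move=> hs; have E p := form_expE z s nu p (Omega2_vanishes s p hs).
have even p : parity (z *: (s p : multiform _ _)) = z *: (s p : multiform _ _).
  by rewrite parityZ Omega2_even.
congr (_, _).
  apply/funext => p; rewrite /exp_form -[LHS]/((form_exp _ p : multiform _ _) *
    kappa.1 p).
  by rewrite E scalerAl.
rewrite form_pullback_even => [|p]; last by rewrite E parityZ parity_mexp.
apply/funext => p; rewrite /exp_form.
rewrite -[LHS]/(comap (tangent_map F p) (form_exp _ (F p)) * (kappa.2 p :
  multiform _ _)).
by rewrite E comapZ comap_mexp comapZ scalerAl.
Qed.

End RelativeForms.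

Theorem lemma6p1 (R : realType) (G : lie_group R)
    (G_compact : compact [set: G]) (G_connected : connected [set: G])
    (M N : manifold R) (F : M -> N)
    (aM : lie_action G M) (aN : lie_action G N) (k : nat)
    (varpi : rel_form M N) (mu : lie_alg G -> rel_form M N)
    (nu : N -> lie_alg G -> R) (kappa : rel_form M N) (s : dform N) (z : R[i])
    (hHam : rel_hamiltonian_space F aM aN k varpi mu)
    (hsplit : basic_splitting F aM aN k mu nu kappa)
    (hs : Omega 2 s)
    (hvarpi : varpi = rel_act F s kappa) :
  let E := rel_cartan_act F (cartan_exp (z_s_minus_nu z s nu)) (fun=> kappa) in
  rel_cartan aM aN E /\ forall xi, rel_cartan_d F aM aN E xi = 0.
Proof.
move=> E; set s' := form_pullback F s.
pose nuN xi p := nu p xi; pose nuM xi p := nu (F p) xi.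
have EE xi : E xi = (exp_form z s kappa.1 (nuN xi), exp_form z s' kappa.2 (nuM xi)).
  exact: (rel_act_exp F z s (nuN xi) kappa hs).
have s_even p : parity (s p : multiform _ _) = s p by exact: Omega2_even.
have s_vanishes p : vanishes 1 (s p : multiform _ _) by exact: Omega2_vanishes.
have s'_even p : parity (s' p : multiform _ _) = s' p.
  by rewrite -[s' p]/(comap (tangent_map F p) (s (F p))) -comap_parity s_even.
have s'_vanishes p : vanishes 1 (s' p : multiform _ _).
  by move=> us hus; apply: s_vanishes; rewrite size_map.
have [F_smooth _ _ d_varpi varpi_inv _ _ mu_equiv mu_moment _] := hHam.
have [nu_lin nu_smooth [[k1_total _ _] [k2_total _ _]] d_kappa kappa_inv
  kappa_basic mu_split] := hsplit.
have s_total : Omega_total s by case: hs.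
have s'_total : Omega_total s' by exact: Omega_total_pullback.
have nuN_smooth xi : smooth_cfun (fun p => (nuN xi p)%:C).
  exact: smooth_cfun_real (nu_smooth xi).
have nuM_smooth xi : smooth_cfun (fun p => (nuM xi p)%:C).
  exact: (smooth_cfun_comp F F_smooth _ (nuN_smooth xi)).
have varpiE : varpi = (form_wedge s kappa.1, form_wedge s' kappa.2).
  by rewrite hvarpi /rel_act form_pullback_even.
have muE xi : mu xi = (form_wedge (form_of_fun (nuN xi)) kappa.1,
    form_wedge (form_of_fun (nuM xi)) kappa.2).
  by rewrite mu_split -[RHS](rel_act_fun F (nuN xi) kappa).
have nuN_total xi : Omega_total (form_of_fun (nuN xi)) := Omega_total_scalar _
  (nuN_smooth xi).
have nuM_total xi : Omega_total (form_of_fun (nuM xi)) := Omega_total_scalar _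
  (nuM_smooth xi).
have dk1 p : ext_d kappa.1 p = 0 :> multiform _ _.
  exact: (congr1 (fun a : rel_form M N => a.1 p) d_kappa).
have Fk1 p : form_pullback F kappa.1 p = ext_d kappa.2 p :> multiform _ _.
  have /eqP := congr1 (fun a : rel_form M N => a.2 p) d_kappa.
  by rewrite subr_eq0 => /eqP.
have vk1 xi p : contr (fundamental aN xi p) (kappa.1 p) = 0.
  exact: (congr1 (fun a : rel_form M N => a.1 p) (kappa_basic xi)).
have vk2 xi p : contr (fundamental aM xi p) (kappa.2 p) = 0.
  have /eqP := congr1 (fun a : rel_form M N => a.2 p) (kappa_basic xi).
  by rewrite oppr_eq0 => /eqP.
have subK (A B : multiform (tangent_space M) R[i]) : A - (B + A) = - B.
  by rewrite opprD addrCA subrr addr0.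
(* The first component of $d_F(s\cdot\kappa)=0$ is $ds\wedge\kappa_1+s\wedge d\kappa_1=0$, whose
   second term vanishes. *)
have dsk1 p : (ext_d s p : multiform _ _) * kappa.1 p = 0.
  have h : ext_d (form_wedge s kappa.1) p = 0 :> multiform _ _.
    by move: d_varpi; rewrite varpiE => /(congr1 (fun a : rel_form M N => a.1 p)).
  by move: h; rewrite ext_dM // dk1 mulr0 addr0.
(* In the second component $F^*s\wedge F^*\kappa_1$ cancels $F^*s\wedge d\kappa_2$, leaving
   $-d(F^*s)\wedge\kappa_2=0$. *)
have dsk2 p : (ext_d s' p : multiform _ _) * kappa.2 p = 0.
  have h : form_pullback F (form_wedge s kappa.1) p - ext_d (form_wedge s'
    kappa.2) p = 0 :> multiform _ _.
    by move: d_varpi; rewrite varpiE => /(congr1 (fun a : rel_form M N => a.2 p)).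
  move: h; rewrite ext_dM // s'_even -Fk1.
  rewrite -[form_pullback F (form_wedge _ _) p]/(comap (tangent_map F p)
    ((s (F p) : multiform _ _) * kappa.1 (F p))) comapM.
  rewrite -[comap _ (s (F p))]/(s' p) -[comap _ _]/(form_pullback F kappa.1 p).
  by rewrite subK => /eqP; rewrite oppr_eq0 => /eqP.
have dnk1 xi p : (ext_d (form_of_fun (nuN xi)) p : multiform _ _) * kappa.1 p =
    - (contr (fundamental aN xi p) (s p) * (kappa.1 p : multiform _ _)).
  have h : ext_d (form_wedge (form_of_fun (nuN xi)) kappa.1) p =
      - contr (fundamental aN xi p) ((s p : multiform _ _) * kappa.1 p) :>
        multiform _ _.
    have := congr1 (fun a : rel_form M N => a.1 p) (mu_moment xi).
    by rewrite muE varpiE.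
  by move: h; rewrite ext_dM // dk1 mulr0 addr0 contrM vk1 mulr0 addr0.
(* The minus sign of the moment equation meets the one in the second component of [rel_int_mult]; as
   before, $F^*\kappa_1=d\kappa_2$ removes the undifferentiated $\nu$ term. *)
have dnk2 xi p : (ext_d (form_of_fun (nuM xi)) p : multiform _ _) * kappa.2 p =
    - (contr (fundamental aM xi p) (s' p) * (kappa.2 p : multiform _ _)).
  have h : form_pullback F (form_wedge (form_of_fun (nuN xi)) kappa.1) p
      - ext_d (form_wedge (form_of_fun (nuM xi)) kappa.2) p =
      - - contr (fundamental aM xi p) ((s' p : multiform _ _) * kappa.2 p) :>
        multiform _ _.
    have := congr1 (fun a : rel_form M N => a.2 p) (mu_moment xi).
    by rewrite muE varpiE.
  move: h; rewrite ext_dM // opprK contrM vk2 mulr0 addr0 -Fk1 => <-.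
  rewrite -[form_pullback F (form_wedge _ _) p]/(comap (tangent_map F p)
    (scalar_form (nu (F p) xi)%:C * (kappa.1 (F p) : multiform _ _))) comapM
      comap_scalar.
  rewrite -[form_of_fun _ p]/(scalar_form (nu (F p) xi)%:C) parity_scalar.
  rewrite -[comap _ _]/(form_pullback F kappa.1 p).
  by rewrite subK opprK.
split.
  have -> : E = fun xi => (exp_form z s kappa.1 (nuN xi), exp_form z s' kappa.2
    (nuM xi)).
    by apply/funext => xi; exact: EE.
  split.
    apply: (cartan_exp_form aN z s kappa.1 nu) => //.
    - by move=> g; exact: (congr1 fst (kappa_inv g)).
    - by move=> g; have := congr1 fst (varpi_inv g); rewrite varpiE.
    - by move=> g xi; have := congr1 fst (mu_equiv g xi); rewrite !muE.
  apply: (cartan_exp_form aM z s' kappa.2 (fun p => nu (F p))) => //.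
  - by move=> g; exact: (congr1 snd (kappa_inv g)).
  - by move=> g; have := congr1 snd (varpi_inv g); rewrite varpiE.
  - by move=> g xi; have := congr1 snd (mu_equiv g xi); rewrite !muE.
move=> xi.
have dE1 p : (ext_d (exp_form z s kappa.1 (nuN xi)) p : multiform _ _)
    - contr (fundamental aN xi p) (exp_form z s kappa.1 (nuN xi) p) = 0.
  by rewrite ext_d_exp_form // dk1 mulr0 scaler0.
(* Here $d\kappa_2=F^*\kappa_1$ turns the remaining $e^{-z\nu_\xi\circ F}e^{zF^*s}\,d\kappa_2$ into
   the pullback of the component on $N$. *)
have dE2 p : (ext_d (exp_form z s' kappa.2 (nuM xi)) p : multiform _ _)
    - contr (fundamental aM xi p) (exp_form z s' kappa.2 (nuM xi) p) =
    form_pullback F (exp_form z s kappa.1 (nuN xi)) p.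
  rewrite ext_d_exp_form // -Fk1.
  rewrite -[RHS]/(comap (tangent_map F p) (cexp (- z * (nuM xi p)%:C) *:
    (mexp (z *: (s (F p) : multiform _ _)) * kappa.1 (F p)))).
  by rewrite comapZ comapM comap_mexp comapZ.
have E1 : (fun zeta => (E zeta).1) = fun zeta => exp_form z s kappa.1 (nuN zeta).
  by apply/funext => zeta; rewrite EE.
have E2 : (fun zeta => (E zeta).2) = fun zeta => exp_form z s' kappa.2 (nuM zeta).
  by apply/funext => zeta; rewrite EE.
rewrite /rel_cartan_d E1 E2 EE; congr (_, _); apply/funext => p; first exact: dE1.
apply/eqP; rewrite subr_eq0; apply/eqP/esym; exact: dE2.
Qed.
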